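(* Let $I\subset\mathbf k[\mathbf x]$ be a monomial ideal with cofinite support and $x_i\notin I$ for all $i$, let $G=\operatorname{Aut}_{\mathbf k}(\mathbf k[\mathbf x]/I)$ with unipotent radical $R$, and write $G^0=R\rtimes L$ with $L$ reductive. Then the group $L$ is isomorphic to the subgroup $L_1$ of $G$ generated by $T$ and the subgroups $U_\alpha$ with $s(\alpha)=0$ and such that both $\alpha$ and $-\alpha$ are roots, i.e. belong to $\mathcal R(I)$. Moreover, if we use the basis $\{\overline x_i\}_{1\le i\le n}$ of $\mathfrak m/\mathfrak m^2$ to identify $\mathrm{GL}(\mathfrak m/\mathfrak m^2)$ with $\mathrm{GL}_n(\mathbf k)$, then, up to permuting the variables, $L$ is a standard Levi subgroup of $\mathrm{GL}_n(\mathbf k)$. In particular, it is isomorphic to $\prod_{j=1}^r\mathrm{GL}_{m_j}(\mathbf k)$, where $m_1+\cdots+m_r=n$.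
   Context: Setting: $\mathbf k$ is an algebraically closed field of characteristic zero, $n\ge1$, $M=\mathbb Z^n$ with canonical basis $e_1,\dots,e_n$, and $e_1^*,\dots,e_n^*$ is the dual basis of $N_{\mathbf k}=\operatorname{Hom}(M,\mathbf k)$. $\mathbf k[\mathbf x]=\mathbf k[x_1,\dots,x_n]$ and $\mathbf x^m=x_1^{m_1}\cdots x_n^{m_n}$. For a monomial ideal $I$, $\operatorname{supp}(I)=\{m\in\mathbb Z^n_{\ge0}:\mathbf x^m\in I\}$; $I$ has cofinite support if $\mathbb Z^n_{\ge0}\setminus\operatorname{supp}(I)$ is finite. Set $A=\mathbf k[\mathbf x]/I$, let $\mathfrak m$ be the maximal ideal of $A$, and let $\overline x_i$ denote the class of $x_i$. For $\alpha\in\mathbb Z^n$, $s(\alpha)$ is the sum of its coordinates. For $\alpha\in\mathbb Z^n$ and $p\in N_{\mathbf k}$, $\partial_{\alpha,p}$ denotes the homogeneous derivation $\mathbf x^m\mapsto p(m)\mathbf x^{m+\alpha}$ of $\mathbf k[\mathbf x]$ (whenever it maps $\mathbf k[\mathbf x]$ to itself), and $\overline\partial_{\alpha,p}$ the derivation induced on $A$ when $\partial_{\alpha,p}(I)\subseteq I$. A root is a degree $\alpha\ne0$ for which there is a nonzero homogeneous derivation of $A$ of degree $\alpha$; $\mathcal R(I)$ is the set of roots. Roots with $s(\alpha)=0$ are all of the form $\alpha=e_i-e_j$ with $i\neq j$, and for such a root the homogeneous derivations of degree $\alpha$ are the multiples of $\overline\partial_{\alpha,e_j^*}$ (the derivation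 sending $\overline x_j\mapsto\overline x_i$ and $\overline x_k\mapsto0$ for $k\ne j$). For such a root, $U_\alpha=\{\exp(t\,\overline\partial_{\alpha,e_j^*}):t\in\mathbf k\}$. $G$ is a linear algebraic group with neutral component $G^0$, and $T\subset G$ is the maximal torus acting by $\overline x_i\mapsto t_i\overline x_i$. Every automorphism of $A$ stabilizes $\mathfrak m$, so $G$ acts on $\mathfrak m/\mathfrak m^2$; let $a\colon G\to\mathrm{GL}(\mathfrak m/\mathfrak m^2)$ be the resulting morphism. Its kernel $U_1$ is a connected unipotent normal subgroup of $G$, hence contained in $R$, so that $L$ is naturally a subgroup of $G/U_1$, and thus of $\mathrm{GL}(\mathfrak m/\mathfrak m^2)$, via $a$. A standard Levi subgroup of $\mathrm{GL}_n(\mathbf k)$ is a subgroup of block diagonal matrices $\prod_{j=1}^r\mathrm{GL}_{m_j}(\mathbf k)$ for some $m_1+\dots+m_r=n$.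
   Formalization: For an arbitrary L the claim that its image in GL_n is a standard Levi up to permuting variables fails (I=(x²,xy,y³), L=vTv⁻¹, v=exp(x∂_y)); it is stated for uLu⁻¹ with some u in R, where u=1 if L contains T. The isomorphisms hold for every L. *)

(* Defs.v *)
From HB Require Import structures.
From Stdlib Require Import ClassicalEpsilon.
From mathcomp Require Import all_boot all_algebra perm falgebra generic_quotient.
From mathcomp Require Import ring_quotient mpoly.

Set Implicit Arguments.
Unset Strict Implicit.
Unset Printing Implicit Defensive.

Import GRing.Theory.
Local Open Scope ring_scope.
Local Open Scope quotient_scope.

Section MonomialIdeal.

Variables (k : fieldType) (n : nat).
Implicit Types (I : {pred {mpoly k[n]}}) (S : 'X_{1..n} -> Prop).

Definition generated_by_monomials S (p : {mpoly k[n]}) : Prop :=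
  exists2 s : seq ({mpoly k[n]} * 'X_{1..n}),
    (forall c, c \in s -> S c.2) & p = \sum_(c <- s) c.1 * 'X_[c.2].

Definition monomial_ideal I : Prop :=
  exists S, forall p, p \in I <-> generated_by_monomials S p.

Definition supp I : {pred 'X_{1..n}} := [pred m | 'X_[m] \in I].

Definition cofinite_support I : Prop :=
  exists s : seq 'X_{1..n}, forall m, m \notin supp I -> m \in s.

(* Properness only excludes the zero ring, which is not a [nzRingType]; it
   holds as soon as n >= 1 and I contains no variable. *)
Record cofinite_monomial_ideal := CofiniteMonomialIdeal {
  ideal_pred :> {mpoly k[n]} -> bool;
  ideal_monomial : monomial_ideal ideal_pred;
  ideal_cofinite : cofinite_support ideal_pred;
  ideal_proper : 1 \notin (ideal_pred : {pred {mpoly k[n]}})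
}.

End MonomialIdeal.

Section Quotient.

Variables (k : fieldType) (n : nat) (I : cofinite_monomial_ideal k n).
Implicit Types (p q : {mpoly k[n]}) (m : 'X_{1..n}).

Fact ideal_pred_closed : idealr_closed (ideal_pred I).
Proof.
have [S defI] := ideal_monomial I; split.
- by apply/defI; exists [::]; rewrite // big_nil.
- exact: ideal_proper.
move=> a u v /defI[s Ss ->] /defI[t St ->]; apply/defI.
exists ([seq (a * c.1, c.2) | c <- s] ++ t).
  by move=> c; rewrite mem_cat => /orP[/mapP[d /Ss Sd ->] // | /St].
rewrite big_cat big_map /= mulr_sumr; congr (_ + _).
by apply: eq_bigr => c _; rewrite mulrA.
Qed.

HB.instance Definition _ :=
  isIdealr.Build {mpoly k[n]} (ideal_pred I) ideal_pred_closed.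

Lemma ideal_supp p m : p \in ideal_pred I -> m \in msupp p ->
  m \in supp (ideal_pred I).
Proof.
have [S defI] := ideal_monomial I => /defI[s Ss ->].
move/msupp_sum_le/flattenP=> [_ /mapP[c cs ->]].
rewrite filter_predT in cs; rewrite (perm_mem (msuppMX _ _)) => /mapP[m' _ ->].
rewrite inE mpolyXD mulrC; apply/defI; exists [:: ('X_[m'], c.2)].
  by move=> d; rewrite inE => /eqP-> /=; apply: Ss.
by rewrite big_seq1.
Qed.

Lemma mem_ideal p :
  (p \in ideal_pred I) = all (fun m => m \in supp (ideal_pred I)) (msupp p).
Proof.
apply/idP/allP => [pI m | sI]; first exact: ideal_supp.
rewrite [p]mpolyE big_seq; apply: rpred_sum => m /sI mI.
by rewrite -mul_mpolyC; apply: idealMr.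
Qed.

Definition standard_monomials : seq 'X_{1..n} :=
  let s := constructive_indefinite_description _ (ideal_cofinite I) in
  undup [seq m <- sval s | m \notin supp (ideal_pred I)].

Lemma mem_standard m :
  (m \in standard_monomials) = (m \notin supp (ideal_pred I)).
Proof.
rewrite /standard_monomials mem_undup; case: constructive_indefinite_description.
by move=> s /= sI; rewrite mem_filter; case: (boolP (m \in _)) => //= /sI.
Qed.

Definition quot_alg : Type :=
  {ideal_quot (ideal_pred I : idealr {mpoly k[n]})}.
HB.instance Definition _ := GRing.ComNzRing.on quot_alg.

Definition mod_ideal p : quot_alg := \pi_quot_alg p.

Lemma mod_ideal_is_zmod_morphism : zmod_morphism mod_ideal.
Proof. by move=> p q; rewrite /mod_ideal rmorphB. Qed.
Lemma mod_ideal_is_monoid_morphism : monoid_morphism mod_ideal.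
Proof. by split=> [|p q]; rewrite /mod_ideal (rmorph1, rmorphM). Qed.
HB.instance Definition _ := GRing.isZmodMorphism.Build {mpoly k[n]} quot_alg
  mod_ideal mod_ideal_is_zmod_morphism.
HB.instance Definition _ := GRing.isMonoidMorphism.Build {mpoly k[n]} quot_alg
  mod_ideal mod_ideal_is_monoid_morphism.

Lemma mod_ideal_repr (a : quot_alg) : mod_ideal (repr a) = a.
Proof. exact: reprK. Qed.

Lemma mod_idealP (a : quot_alg) : exists p, a = mod_ideal p.
Proof. by exists (repr a); rewrite mod_ideal_repr. Qed.

Lemma mod_ideal_eq0 p : (mod_ideal p == 0) = (p \in ideal_pred I).
Proof.
rewrite -[in RHS](subr0 p) Quotient.idealrBE -/(mod_ideal p).
by rewrite -[X in _ = (_ == X)]/(mod_ideal 0) rmorph0.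
Qed.

Definition quot_scale (c : k) (a : quot_alg) : quot_alg := mod_ideal c%:MP * a.

Fact quot_scaleA c d a : quot_scale c (quot_scale d a) = quot_scale (c * d) a.
Proof. by rewrite /quot_scale mulrA -rmorphM -mpolyCM. Qed.
Fact quot_scale1 : left_id 1 quot_scale.
Proof. by move=> a; rewrite /quot_scale rmorph1 mul1r. Qed.
Fact quot_scaleDr : right_distributive quot_scale +%R.
Proof. by move=> c a b; apply: mulrDr. Qed.
Fact quot_scaleDl a : {morph quot_scale^~ a : c d / c + d}.
Proof. by move=> c d; rewrite /quot_scale mpolyCD rmorphD mulrDl. Qed.
HB.instance Definition _ := GRing.Zmodule_isLmodule.Build k quot_alg
  quot_scaleA quot_scale1 quot_scaleDr quot_scaleDl.
Fact quot_scaleAl (c : k) (a b : quot_alg) : c *: (a * b) = (c *: a) * b.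
Proof. exact: mulrA. Qed.
HB.instance Definition _ := GRing.Lmodule_isLalgebra.Build k quot_alg
  quot_scaleAl.
HB.instance Definition _ := GRing.Lalgebra_isComAlgebra.Build k quot_alg.

Lemma mod_idealZ : scalable mod_ideal.
Proof. by move=> c p; rewrite -mul_mpolyC rmorphM. Qed.
HB.instance Definition _ := GRing.isScalable.Build k {mpoly k[n]} quot_alg
  *:%R mod_ideal mod_idealZ.

Fact quot_vector_axiom : vector_axiom (size standard_monomials) quot_alg.
Proof.
pose s := standard_monomials; pose m j : 'X_{1..n} := nth 0%MM s j.
have Us : uniq s by apply: undup_uniq.
have sI p j : p \in ideal_pred I -> (j < size s)%N -> p@_(m j) = 0.
  move=> pI js; apply/memN_msupp_eq0/negP => /(ideal_supp pI).
  by apply/negP; rewrite -mem_standard mem_nth.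
pose f (a : quot_alg) : 'rV[k]_(size s) := \row_j (repr a)@_(m j).
have fE p : f (mod_ideal p) = \row_j p@_(m j).
  apply/rowP=> j; rewrite !mxE; apply/eqP; rewrite -subr_eq0 -mcoeffB.
  by rewrite sI // -mod_ideal_eq0 rmorphB subr_eq0 /= mod_ideal_repr.
have fL : linear f.
  move=> c a b; have [p ->] := mod_idealP a; have [q ->] := mod_idealP b.
  rewrite -linearP !fE; apply/rowP=> j; rewrite !mxE.
  by rewrite mcoeffD mcoeffZ.
exists f => //.
pose g (v : 'rV[k]_(size s)) := mod_ideal (\sum_j v 0 j *: 'X_[m j]).
have fK : cancel g f.
  move=> v; rewrite /g fE; apply/rowP=> j; rewrite mxE raddf_sum /=.
  rewrite (bigD1 j) //= mcoeffZ mcoeffX eqxx mulr1 big1 ?addr0 // => i.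
  rewrite -val_eqE => ij.
  by rewrite mcoeffZ mcoeffX nth_uniq // (negPf ij) mulr0.
have f0 a : f a = 0 -> a = 0.
  have [p ->] := mod_idealP a; rewrite fE => /rowP p0.
  apply/eqP; rewrite mod_ideal_eq0 mem_ideal; apply/allP => e.
  rewrite mcoeff_msupp; apply: contraR; rewrite -mem_standard => es.
  have js : (index e s < size s)%N by rewrite index_mem.
  by have := p0 (Ordinal js); rewrite !mxE /m nth_index // => ->.
exists g => // a; apply/eqP; rewrite -subr_eq0; apply/eqP/f0.
by rewrite -scaleN1r addrC fL fK scaleN1r addNr.
Qed.
HB.instance Definition _ :=
  Lmodule_hasFinDim.Build k quot_alg quot_vector_axiom.
HB.instance Definition _ := Algebra_isFalgebra.Build k quot_alg.

Definition xbar (i : 'I_n) : quot_alg := mod_ideal 'X_i.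

End Quotient.

(* Linear algebraic groups are closed subgroups of GL(V), for V of finite
   dimension over an algebraically closed field; a subset of GL(V) is a predicate
   on 'End(V).  Since GL(V) is the affine variety {(g, g^-1)}, its regular
   functions are the polynomials in the entries of g and g^-1, and its closed
   subsets are cut out by polynomials in the entries of g alone. *)

Section PolynomialMaps.

Variables (k : fieldType) (V W : vectType k).

Definition polynomial_fun (f : V -> k) : Prop :=
  exists P : {mpoly k[\dim {:V}]},
    forall v, f v = P.@[fun i => coord (vbasis {:V}) i v].

Definition polynomial_map (F : V -> W) : Prop :=
  forall j, polynomial_fun (fun v => coord (vbasis {:W}) j (F v)).

End PolynomialMaps.

Arguments polynomial_fun {k V}.
Arguments polynomial_map {k V W}.

Section AlgebraicGroups.

Variables (k : fieldType) (V : vectType k).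
Implicit Types (g h u : 'End(V)) (X Y G H L R : 'End(V) -> Prop).

Definition included X Y : Prop := forall g, X g -> Y g.

Definition GL : 'End(V) -> Prop := fun g => lker g == 0%VS.

Definition zariski_closed X : Prop :=
  exists2 S : ('End(V) -> k) -> Prop,
    forall f, S f -> polynomial_fun f &
    forall g, X g <-> GL g /\ forall f, S f -> f g = 0.

Definition subgroup H : Prop :=
  [/\ included H GL, H \1%VF, forall g h, H g -> H h -> H (g \o h)%VF &
      forall g, H g -> H (g^-1)%VF].

Definition generated_subgroup X : 'End(V) -> Prop :=
  fun g => forall H, subgroup H -> included X H -> H g.

Definition normal_in G H : Prop :=
  included H G /\ forall g h, G g -> H h -> H (g \o h \o g^-1)%VF.

Definition conjugate u L : 'End(V) -> Prop :=
  fun g => exists2 h, L h & g = (u \o h \o u^-1)%VF.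

Definition algebraic_group H : Prop := subgroup H /\ zariski_closed H.

Definition connected X : Prop :=
  forall Y Z, zariski_closed Y -> zariski_closed Z ->
    (forall g, X g -> Y g \/ Z g) -> (forall g, X g -> Y g -> Z g -> False) ->
  included X Y \/ included X Z.

Definition neutral_component G : 'End(V) -> Prop :=
  fun g => exists C, [/\ included C G, connected C, C \1%VF & C g].

Definition unipotent u : Prop := exists N, forall v, iter N (u - \1)%VF v = 0.

Definition connected_normal_unipotent G R : Prop :=
  [/\ algebraic_group R, connected R, normal_in G R & included R unipotent].

Definition is_unipotent_radical G R : Prop :=
  connected_normal_unipotent G R /\
  forall H, connected_normal_unipotent G H -> included H R.

Definition reductive L : Prop :=
  algebraic_group L /\ is_unipotent_radical L (eq \1%VF).

End AlgebraicGroups.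

Arguments GL {k} V.
Arguments included {k V}.
Arguments neutral_component {k V}.
Arguments reductive {k V}.
Arguments is_unipotent_radical {k V}.
Arguments conjugate {k V}.

Section Morphisms.

Variable k : fieldType.

Definition regular_on (V W : vectType k) (X : 'End(V) -> Prop)
    (F : 'End(V) -> 'End(W)) : Prop :=
  exists2 P : 'End(V) * 'End(V) -> 'End(W), polynomial_map P &
    forall g, X g -> F g = P (g, g^-1%VF).

Definition algebraic_hom (V W : vectType k) (H1 : 'End(V) -> Prop)
    (H2 : 'End(W) -> Prop) (F : 'End(V) -> 'End(W)) : Prop :=
  [/\ regular_on H1 F, forall g, H1 g -> H2 (F g) &
      forall g h, H1 g -> H1 h -> F (g \o h)%VF = (F g \o F h)%VF].

Definition algebraic_iso_by (V W : vectType k) (H1 : 'End(V) -> Prop)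
    (H2 : 'End(W) -> Prop) (F : 'End(V) -> 'End(W)) : Prop :=
  [/\ algebraic_group H1, algebraic_group H2, algebraic_hom H1 H2 F &
      exists F', [/\ algebraic_hom H2 H1 F', forall g, H1 g -> F' (F g) = g &
                     forall h, H2 h -> F (F' h) = h]].

Definition algebraic_isomorphic (V W : vectType k) (H1 : 'End(V) -> Prop)
    (H2 : 'End(W) -> Prop) : Prop :=
  exists F, algebraic_iso_by H1 H2 F.

(* G is the semidirect product of R and L: R is normal in G and the multiplication map R x L -> G is an
   isomorphism of varieties, with inverse g |-> (rho g, lambda g). *)
Definition semidirect_product (V : vectType k)
    (G R L : 'End(V) -> Prop) : Prop :=
  [/\ algebraic_group R, algebraic_group L, normal_in G R, included L G &
      exists rho lambda : 'End(V) -> 'End(V),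
        [/\ regular_on G rho, regular_on G lambda,
            forall g, G g ->
              [/\ R (rho g), L (lambda g) & g = (rho g \o lambda g)%VF] &
            forall r l, R r -> L l ->
              rho (r \o l)%VF = r /\ lambda (r \o l)%VF = l]].

End Morphisms.

Definition unit_vector {n} (i : 'I_n) : 'rV[int]_n := delta_mx 0 i.

Definition coord_sum {n} (alpha : 'rV[int]_n) : int := \sum_i alpha 0 i.

Definition exponent {n} (m : 'X_{1..n}) : 'rV[int]_n := \row_i (m i)%:Z.

Section HomogeneousDerivations.

Variables (k : fieldType) (n : nat).

Definition dual_vector (j : 'I_n) (m : 'rV[int]_n) : k := (m 0 j)%:~R.

(* x^beta, or 0 when beta has a negative coordinate. *)
Definition laurent_monomial (beta : 'rV[int]_n) : {mpoly k[n]} :=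
  if [forall i, 0 <= beta 0 i] then 'X_[[multinom absz (beta ord0 i) | i < n]]
  else 0.

(* Where the derivation x^m |-> p(m) x^(m + alpha) does not preserve k[x], the
   offending terms are dropped. *)
Definition homog_derivation (alpha : 'rV[int]_n) (p : 'rV[int]_n -> k)
    (f : {mpoly k[n]}) : {mpoly k[n]} :=
  \sum_(m <- msupp f)
    (f@_m * p (exponent m)) *: laurent_monomial (exponent m + alpha).

End HomogeneousDerivations.

Section AutomorphismGroup.

Variables (k : fieldType) (n : nat) (I : cofinite_monomial_ideal k n).
Local Notation A := (quot_alg I).
Implicit Types (D g : 'End(A)) (alpha beta : 'rV[int]_n) (t : k).

Definition Aut : 'End(A) -> Prop := fun g => GL A g /\ ahom_in {:A} g.

Definition torus : 'End(A) -> Prop := fun g =>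
  Aut g /\ exists2 t : 'I_n -> k, forall i, t i != 0 &
    forall i, g (xbar I i) = t i *: xbar I i.

Definition derivation D : Prop := forall a b, D (a * b) = D a * b + a * D b.

Definition in_degree beta (a : A) : Prop :=
  a = 0 \/
  exists (m : 'X_{1..n}) (c : k), exponent m = beta /\ a = c *: mod_ideal I 'X_[m].

Definition homogeneous alpha D : Prop :=
  forall beta a, in_degree beta a -> in_degree (beta + alpha) (D a).

Definition root alpha : Prop :=
  alpha != 0 /\ exists D, [/\ derivation D, homogeneous alpha D & D != 0].

(* D is the derivation of A induced by d; it exists iff d maps I into I. *)
Definition induces (d : {mpoly k[n]} -> {mpoly k[n]}) D : Prop :=
  forall f, D (mod_ideal I f) = mod_ideal I (d f).

(* g = exp (t D); the hypothesis on N makes all further terms vanish. *)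
Definition is_exp t D g : Prop :=
  forall a, exists2 N, iter N D a = 0 &
    g a = \sum_(j < N) (t ^+ j / j`!%:R) *: iter j D a.

Definition root_subgroup alpha : 'End(A) -> Prop := fun g =>
  exists i j t D,
    [/\ i != j, alpha = unit_vector i - unit_vector j,
        induces (homog_derivation alpha (dual_vector k j)) D & is_exp t D g].

Definition L1 : 'End(A) -> Prop := generated_subgroup (fun g =>
  torus g \/
  exists alpha, [/\ coord_sum alpha = 0, root alpha, root (- alpha) &
                    root_subgroup alpha g]).

(* The maximal ideal of A is the ideal generated by the classes of the
   variables. *)
Definition max_ideal : {vspace A} := (\sum_i <[xbar I i]> * {:A})%VS.

(* f is the matrix of the action of g on max_ideal / max_ideal^2, with respect
   to the basis given by the classes of the variables. *)
Definition cotangent_action g (f : 'End('cV[k]_n)) : Prop :=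
  forall v : 'cV[k]_n,
    g (\sum_i v i 0 *: xbar I i) - \sum_i (f v) i 0 *: xbar I i
      \in (max_ideal * max_ideal)%VS.

End AutomorphismGroup.

Arguments Aut {k n} I.
Arguments torus {k n} I.
Arguments L1 {k n} I.

Section StandardLevi.

Variables (k : fieldType) (n : nat).

Definition mx_end (M : 'M[k]_n) : 'End('cV[k]_n) :=
  linfun (mulmx M : 'cV[k]_n -> 'cV[k]_n).

Definition standard_levi r (m : 'I_r -> nat) (sum_m : (\sum_j m j)%N = n) :
    'End('cV[k]_n) -> Prop := fun f =>
  exists2 B : forall j, 'M[k]_(m j), forall j, B j \in unitmx &
    f = mx_end (castmx (sum_m, sum_m) (\mxdiag_j B j)).

End StandardLevi.

Arguments standard_levi k {n r m} sum_m.

(* Main.v *)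
From HB Require Import structures.
From Stdlib Require Import Classical FunctionalExtensionality PropExtensionality.
Require Import Defs.
From mathcomp Require Import all_boot all_order all_algebra perm falgebra mpoly.

Set Implicit Arguments.
Unset Strict Implicit.
Unset Printing Implicit Defensive.

Import GRing.Theory.
Local Open Scope ring_scope.

(** The automorphism group of the quotient is compared with a group of matrices
    through the linear part lin g of an automorphism g, which is its action on
    m / m^2.  The combinatorial datum is the preorder below on the variables,
    for which x_i lies below x_j when x_i d/dx_j preserves the ideal.  Because the
    ideal is monomial, an entry (i, j) of the linear part of any derivation of the
    quotient can be nonzero only if x_i lies below x_j (derivation_below).
    Conjugating the derivations x_i d/dx_j by g gives derivations again, so lin g
    normalizes the incidence algebra of the preorder (lin_normalizes_below).

    Consequently lin g permutes the finitely many coordinate subspaces which are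
    stable by the incidence algebra, and fixes each of them when g lies in the
    neutral component: there lin g is itself in the incidence algebra
    (neutral_upper).  An invertible matrix of the incidence algebra is the product
    of a block matrix for the equivalence relation of the preorder and of a matrix
    1 + X with X strict.

    Accordingly, the unipotent radical R is the set, called radical, of the g for
    which lin g - 1 is strict (unipotent_radicalE).  It is unipotent since it
    raises suitable weights of the monomials, connected since a unipotent group in
    characteristic zero contains a dense part of a curve through each element and
    the identity (connected_unipotent_subgroup), and normal because lin g
    normalizes the preorder.  Conversely the strictly upper part is all that a
    normal unipotent subgroup can have: otherwise the trace of the product of one
    of its elements with a conjugate would be wrong
    (normal_unipotent_radical).

    On the other hand a matrix of the incidence algebra acts on the quotient by
    linear substitution of the variables.  The substitutions by invertible block
    matrices form a group levi, which Gaussian elimination identifies with the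
    subgroup generated by the torus and the root subgroups of opposite roots of
    degree zero (L1_levi).  The groups L and levi are both complements of R, so
    the projections onto each of them along R are inverse isomorphisms between
    them (L_levi_iso).

    For the position of L in GL_n, take a diagonal matrix t which is scalar on
    the blocks, with distinct values on distinct blocks.  The element of L above t
    is central in L, and a triangular system of equations produces u in R
    conjugating its linear part to t (strict_conjugation).  The linear part of
    u L u^-1 commutes with t, hence consists of block matrices
    (block_conjugator).  If L contains the torus, the element of L above t is the
    diagonal substitution itself and u = 1 is possible.  Reordering the variables
    turns the block matrices into a standard Levi subgroup (classes_interval,
    relation_group_perm). *)

(** * Polynomial functions and polynomial maps *)

Section PolynomialFunctions.

Variables (k : fieldType) (V : vectType k).
Implicit Types (f h : V -> k) (W : vectType k).

Lemma polynomial_fun_ext f h : f =1 h -> polynomial_fun f -> polynomial_fun h.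
Proof. by move=> fh [P fP]; exists P => v; rewrite -fh. Qed.

Lemma polynomial_cst (c : k) : polynomial_fun (fun _ : V => c).
Proof. by exists c%:MP => v; rewrite mevalC. Qed.

Lemma polynomialD f h :
  polynomial_fun f -> polynomial_fun h -> polynomial_fun (fun v => f v + h v).
Proof. by move=> [P fP] [Q hQ]; exists (P + Q) => v; rewrite mevalD -fP -hQ. Qed.

Lemma polynomialM f h :
  polynomial_fun f -> polynomial_fun h -> polynomial_fun (fun v => f v * h v).
Proof. by move=> [P fP] [Q hQ]; exists (P * Q) => v; rewrite mevalM -fP -hQ. Qed.

Lemma polynomial_sum (J : Type) (r : seq J) (F : J -> V -> k) :
  (forall j, polynomial_fun (F j)) ->
  polynomial_fun (fun v => \sum_(j <- r) F j v).
Proof.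
move=> polF; elim: r => [|j r IHr].
  by apply: polynomial_fun_ext (polynomial_cst 0) => v; rewrite big_nil.
apply: polynomial_fun_ext (polynomialD (polF j) IHr) => v.
by rewrite big_cons.
Qed.

Lemma polynomialX f d : polynomial_fun f -> polynomial_fun (fun v => f v ^+ d).
Proof.
move=> polf; elim: d => [|d IHd]; first exact: polynomial_cst.
by apply: polynomial_fun_ext (polynomialM polf IHd) => v; rewrite exprS.
Qed.

Lemma polynomial_prod (J : Type) (r : seq J) (F : J -> V -> k) :
  (forall j, polynomial_fun (F j)) ->
  polynomial_fun (fun v => \prod_(j <- r) F j v).
Proof.
move=> polF; elim: r => [|j r IHr].
  by apply: polynomial_fun_ext (polynomial_cst 1) => v; rewrite big_nil.
apply: polynomial_fun_ext (polynomialM (polF j) IHr) => v.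
by rewrite big_cons.
Qed.

Lemma polynomial_coord i : polynomial_fun (fun v : V => coord (vbasis {:V}) i v).
Proof. by exists 'X_i => v; rewrite mevalXU. Qed.

Lemma polynomial_scalar f : scalar f -> polynomial_fun f.
Proof.
move=> linf; pose F := HB.pack_for {scalar V} f (GRing.isLinear.Build _ _ _ _ f linf).
have fF : f =1 F by [].
apply: polynomial_fun_ext (_ : polynomial_fun (fun v =>
  \sum_i coord (vbasis {:V}) i v * f (vbasis {:V})`_i)).
  move=> v; rewrite {2}(coord_vbasis (memvf v)) fF linear_sum.
  by apply: eq_bigr => i _; rewrite linearZ.
apply: polynomial_sum => i.
exact: polynomialM (polynomial_coord i) (polynomial_cst _).
Qed.

Lemma polynomial_map_ext W (F F' : V -> W) :
  F =1 F' -> polynomial_map F -> polynomial_map F'.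
Proof.
by move=> FF' pF j; apply: polynomial_fun_ext (pF j) => v; rewrite FF'.
Qed.

Lemma polynomial_map_scale W f (F : V -> W) :
  polynomial_fun f -> polynomial_map F -> polynomial_map (fun v => f v *: F v).
Proof.
move=> pf pF j; apply: polynomial_fun_ext (polynomialM pf (pF j)) => v.
by rewrite linearZ.
Qed.

Lemma polynomial_mapD W (F F' : V -> W) :
  polynomial_map F -> polynomial_map F' -> polynomial_map (fun v => F v + F' v).
Proof.
move=> pF pF' j; apply: polynomial_fun_ext (polynomialD (pF j) (pF' j)) => v.
by rewrite linearD.
Qed.

Lemma polynomial_map_cst W (w : W) : polynomial_map (fun _ : V => w).
Proof. by move=> j; apply: polynomial_cst. Qed.

Lemma polynomial_map_sum W (J : Type) (r : seq J) (F : J -> V -> W) :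
  (forall j, polynomial_map (F j)) ->
  polynomial_map (fun v => \sum_(j <- r) F j v).
Proof.
move=> pF i; apply: polynomial_fun_ext (polynomial_sum r (fun j => pF j i)) => v.
by rewrite linear_sum.
Qed.

Lemma polynomial_map_linear W (F : V -> W) : linear F -> polynomial_map F.
Proof.
move=> linF j; apply: polynomial_scalar => c u v.
by rewrite linF linearP.
Qed.

End PolynomialFunctions.

Section PolynomialComposition.

Variables (k : fieldType) (V W : vectType k).

Lemma polynomial_comp (F : V -> W) (f : W -> k) :
  polynomial_map F -> polynomial_fun f -> polynomial_fun (fun v => f (F v)).
Proof.
move=> pF [P fP]; apply: polynomial_fun_ext (_ : polynomial_fun (fun v =>
  \sum_(m <- msupp P) P@_m * \prod_i coord (vbasis {:W}) i (F v) ^+ m i)).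
  by move=> v; rewrite fP mevalE.
apply: polynomial_sum => m; apply: polynomialM (polynomial_cst _ _) _.
by apply: polynomial_prod => i; apply: polynomialX; apply: pF.
Qed.

End PolynomialComposition.

Lemma polynomial_map_comp (k : fieldType) (U V W : vectType k) (F : V -> W) (F' : U -> V) :
  polynomial_map F' -> polynomial_map F -> polynomial_map (fun v => F (F' v)).
Proof. by move=> pF' pF j; apply: (polynomial_comp pF' (pF j)). Qed.

Section PolynomialMaps.

Variables (k : fieldType) (V W : vectType k).

(** A linear map is the sum of the rank one maps determined by its values on a
    basis, so it suffices to control these values. *)
Lemma polynomial_map_Hom (U : vectType k) (F : V -> 'Hom(W, U)) :
  (forall w, polynomial_map (fun v => F v w)) -> polynomial_map F.
Proof.
move=> pF; pose e := vbasis {:W}.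
have linE i (u : U) : linear (fun w : W => coord e i w *: u).
  by move=> c w w'; rewrite linearP scalerDl scalerA.
pose E1 i u : {linear W -> U} :=
  HB.pack (fun w : W => coord e i w *: u) (GRing.isLinear.Build _ _ _ _ _ (linE i u)).
pose E i u : 'Hom(W, U) := linfun (E1 i u).
apply: polynomial_map_ext (_ : polynomial_map (fun v => \sum_i E i (F v e`_i))).
  move=> v; apply/lfunP => w; rewrite sum_lfunE [in RHS](coord_vbasis (memvf w)).
  by rewrite linear_sum; apply: eq_bigr => i _; rewrite linearZ lfunE.
apply: polynomial_map_sum => i; apply: polynomial_map_comp (pF _) _.
apply: polynomial_map_linear => c u u'; apply/lfunP => w.
by rewrite add_lfunE scale_lfunE !lfunE /= scalerDr !scalerA mulrC.
Qed.

End PolynomialMaps.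

Lemma polynomial_map_mul (k : fieldType) (V : vectType k) (A : falgType k)
    (F F' : V -> A) :
  polynomial_map F -> polynomial_map F' -> polynomial_map (fun v => F v * F' v).
Proof.
move=> pF pF'; pose e := vbasis {:A}.
apply: polynomial_map_ext (_ : polynomial_map (fun v =>
  \sum_i \sum_j (coord e i (F v) * coord e j (F' v)) *: (e`_i * e`_j))).
  move=> v; rewrite [F v in RHS](coord_vbasis (memvf _)).
  rewrite [F' v in RHS](coord_vbasis (memvf _)).
  rewrite mulr_suml; apply: eq_bigr => i _; rewrite mulr_sumr.
  by apply: eq_bigr => j _; rewrite -scalerAl -scalerAr scalerA.
apply: polynomial_map_sum => i; apply: polynomial_map_sum => j.
by apply: polynomial_map_scale (polynomial_map_cst _ _); apply: polynomialM.
Qed.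

(** * Zariski closed and connected sets of linear automorphisms *)

Section Zariski.

Variables (k : fieldType) (V : vectType k).
Implicit Types (X Y Z : 'End(V) -> Prop).

Lemma closed_equations (J : Type) (F : J -> 'End(V) -> k) :
  (forall j, polynomial_fun (F j)) ->
  zariski_closed (fun g => GL V g /\ forall j, F j g = 0).
Proof.
move=> pF; exists (fun f => exists j, f = F j) => [f [j ->] //|g].
split=> -[Gg Fg]; split=> //; first by move=> _ [j ->].
by move=> j; apply: Fg; exists j.
Qed.

Lemma closed_ext X Y :
  (forall g, X g <-> Y g) -> zariski_closed X -> zariski_closed Y.
Proof. by move=> XY [S pS defX]; exists S => // g; rewrite -XY. Qed.

Lemma closedI X Y :
  zariski_closed X -> zariski_closed Y -> zariski_closed (fun g => X g /\ Y g).
Proof.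
move=> [S pS defX] [S' pS' defY].
exists (fun f => S f \/ S' f) => [f [/pS|/pS']//|g]; rewrite defX defY.
split=> [[[Gg fg] [_ f'g]]|[Gg fg]]; first by split=> // f [/fg|/f'g].
by split; split=> // f Sf; apply: fg; [left|right].
Qed.

Lemma closedU X Y :
  zariski_closed X -> zariski_closed Y -> zariski_closed (fun g => X g \/ Y g).
Proof.
move=> [S pS defX] [S' pS' defY].
exists (fun f => exists f1 f2, [/\ S f1, S' f2 & f = fun g => f1 g * f2 g]).
  by move=> f [f1 [f2 [/pS p1 /pS' p2 ->]]]; apply: polynomialM.
move=> g; rewrite defX defY; split.
  case=> -[Gg fg]; split=> // f [f1 [f2 [S1 S2 ->]]].
    by rewrite (fg f1 S1) mul0r.
  by rewrite (fg f2 S2) mulr0.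
move=> [Gg fg]; case: (classic (forall f, S f -> f g = 0)) => [|nS].
  by left.
right; split=> // f2 S2; apply: NNPP => nf2; apply: nS => f1 S1.
apply/eqP; have /eqP := fg _ (ex_intro _ f1 (ex_intro _ f2 (And3 S1 S2 erefl))).
by rewrite mulf_eq0 => /orP[//|/eqP].
Qed.

Lemma closed_empty : zariski_closed (fun _ : 'End(V) => False).
Proof.
apply: closed_ext (closed_equations (fun _ : unit => polynomial_cst _ 1)) => g.
by split=> // -[_ /(_ tt)/eqP]; rewrite oner_eq0.
Qed.

Lemma closed_ex_seq (J : eqType) (r : seq J) (X : J -> 'End(V) -> Prop) :
  (forall j, zariski_closed (X j)) ->
  zariski_closed (fun g => exists2 j, j \in r & X j g).
Proof.
move=> cX; elim: r => [|j r IHr].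
  by apply: closed_ext closed_empty => g; split=> // -[].
apply: closed_ext (closedU (cX j) IHr) => g; split.
  case=> [Xg|[i ir Xg]]; first by exists j; rewrite ?mem_head.
  by exists i; rewrite // inE ir orbT.
case=> i; rewrite inE => /orP[/eqP->|ir]; first by left.
by right; exists i.
Qed.

Lemma GL_inv (g : 'End(V)) : GL V g -> GL V (g^-1)%VF.
Proof.
move=> Gg; apply/lker0P => x y; move/(congr1 g).
by rewrite !lker0_lfunVK.
Qed.

Lemma GL_comp (g h : 'End(V)) : GL V g -> GL V h -> GL V (g \o h)%VF.
Proof.
move=> /lker0P gi /lker0P hi; apply/lker0P => x y; rewrite !comp_lfunE.
by move/gi/hi.
Qed.

Lemma GL_1 : GL V \1%VF.
Proof. by apply/lker0P => x y; rewrite !id_lfunE. Qed.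

Lemma GL_left_inv (g h : 'End(V)) : (h \o g = \1)%VF -> GL V g.
Proof.
move=> hg; apply/lker0P => x y /(congr1 h).
by rewrite -!comp_lfunE hg !id_lfunE.
Qed.

Lemma inv_unique (g h : 'End(V)) : (h \o g = \1)%VF -> (g^-1)%VF = h.
Proof.
move=> hg; rewrite -[LHS]comp_lfun1l -hg -comp_lfunA.
by rewrite (lker0_compfV (GL_left_inv hg)) comp_lfun1r.
Qed.

Lemma invK_GL (g : 'End(V)) : GL V g -> (g^-1^-1)%VF = g.
Proof. by move=> Gg; apply: inv_unique; rewrite lker0_compfV. Qed.

Lemma inv_comp (g h : 'End(V)) : GL V g -> GL V h ->
  ((g \o h)^-1 = h^-1 \o g^-1)%VF.
Proof.
move=> Gg Gh; apply: inv_unique.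
by rewrite comp_lfunA lker0_compfVK // lker0_compVf.
Qed.

Lemma inv_lfun1 : (\1^-1 = \1 :> 'End(V))%VF.
Proof. by apply: inv_unique; rewrite comp_lfun1l. Qed.

(** If neither of two closed sets contained the image of T, each of them would
    impose a nonzero polynomial equation on the parameter; but the product of
    these two polynomials vanishes on the dense set T. *)
Lemma connected_curve (T : k -> Prop) (gamma : k -> 'End(V)) :
    (forall p : {poly k}, (forall t, T t -> p.[t] = 0) -> p = 0) ->
    polynomial_map (gamma : k^o -> 'End(V)) ->
  connected (fun g => exists2 t, T t & g = gamma t).
Proof.
move=> denseT pgamma.
have polyP (f : 'End(V) -> k) : polynomial_fun f ->
    exists p : {poly k}, forall t, f (gamma t) = p.[t].
  move=> /(polynomial_comp pgamma)[P fP].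
  pose b i : k := coord (vbasis {:k^o}) i (1 : k^o).
  exists (mmap (@polyC k) (fun i => b i *: 'X) P) => t; rewrite fP mevalE /mmap.
  rewrite horner_sum; apply: eq_bigr => m _; rewrite hornerM hornerC; congr (_ * _).
  rewrite /mmap1 horner_prod; apply: eq_bigr => i _.
  rewrite horner_exp hornerZ hornerX; congr (_ ^+ _).
  have -> : coord (vbasis {:k^o}) i (t : k^o) = coord (vbasis {:k^o}) i (t *: (1 : k^o)).
    by congr (coord _ i _); rewrite /GRing.scale /= mulr1.
  by rewrite linearZ mulrC.
move=> Y Z [S pS defY] [S' pS' defZ] XYZ _.
apply: NNPP => nYZ.
have nS (X : 'End(V) -> Prop) (Q : ('End(V) -> k) -> Prop) :
    (forall f, Q f -> polynomial_fun f) ->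
    (forall g, X g <-> GL V g /\ forall f, Q f -> f g = 0) ->
    ~ included (fun g => exists2 t, T t & g = gamma t) X ->
    exists2 p : {poly k}, p != 0 & forall t, X (gamma t) -> p.[t] = 0.
  move=> pQ defX nX; apply: NNPP => np; apply: nX.
  move=> _ [t0 Tt0 ->]; apply/defX; split.
    by case: (XYZ (gamma t0)) => [|/defY[]|/defZ[]] //; exists t0.
  move=> f Qf; have [p fp] := polyP f (pQ f Qf); rewrite fp.
  case: (eqVneq p 0) => [->|p0]; first by rewrite horner0.
  by case: np; exists p => // t /defX[_ /(_ f Qf)]; rewrite fp.
have [p p0 Yp] : exists2 p : {poly k}, p != 0 & forall t, Y (gamma t) -> p.[t] = 0.
  by apply: nS pS defY _ => YY; apply: nYZ; left.
have [q q0 Zq] : exists2 p : {poly k}, p != 0 & forall t, Z (gamma t) -> p.[t] = 0.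
  by apply: nS pS' defZ _ => ZZ; apply: nYZ; right.
suff /eqP : p * q = 0 by rewrite mulf_eq0 (negPf p0) (negPf q0).
apply: denseT => t Tt; rewrite hornerM.
by case: (XYZ (gamma t)) => [|/Yp->|/Zq->]; rewrite ?mul0r ?mulr0 //; exists t.
Qed.

End Zariski.

Section ConnectedGroups.

Variables (k : fieldType) (V : vectType k).
Implicit Types (H X : 'End(V) -> Prop) (g : 'End(V)).

(** Of the two disjoint closed sets covering X, the one containing g0 contains
    every connected part of X through g0. *)
Lemma connected_star X g0 :
    X g0 ->
    (forall g, X g -> exists C, [/\ included C X, connected C, C g0 & C g]) ->
  connected X.
Proof.
move=> Xg0 starX Y Z cY cZ XYZ disj.
have side (W W' : 'End(V) -> Prop) : zariski_closed W -> zariski_closed W' ->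
    (forall g, X g -> W g \/ W' g) -> (forall g, X g -> W g -> W' g -> False) ->
    W g0 -> included X W.
  move=> cW cW' XWW' disjW Wg0 g Xg; have [C [CX cC Cg0 Cg]] := starX g Xg.
  case: (cC W W' cW cW') => [h /CX/XWW' // | h /CX/disjW // | | /(_ _ Cg0)].
    exact.
  by move/(disjW _ Xg0 Wg0).
case: (XYZ _ Xg0) => [/(side Y Z)|/(side Z Y)] sd; [left|right]; apply: sd => //.
  by move=> g /XYZ[]; [right|left].
by move=> g Xg Zg /(disj _ Xg)/(_ Zg).
Qed.

Lemma neutral_component_included H C :
  included C H -> connected C -> C \1%VF -> included C (neutral_component H).
Proof. by move=> CH cC C1 g Cg; exists C. Qed.

Hypothesis char0 : [pchar k] =i pred0.

Lemma natr_neq0 n : (n.+1%:R : k) != 0.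
Proof. by move/pcharf0P: char0 => ->. Qed.

Lemma natr_inj : injective (fun n => n%:R : k).
Proof.
suff leP m n : (m <= n)%N -> m%:R = n%:R :> k -> m = n.
  by move=> m n e; case: (leqP m n) => [/leP->//|/ltnW/leP->].
move=> mn /eqP; rewrite eq_sym -subr_eq0 -natrB //.
case d: (n - m)%N => [|d']; last by rewrite (negPf (natr_neq0 _)).
by move=> _; apply/eqP; rewrite eqn_leq mn -subn_eq0 d.
Qed.

Lemma poly_nat_eq0 (p : {poly k}) : (forall s, p.[s%:R] = 0) -> p = 0.
Proof.
move=> p0; apply/eqP; apply/negP => /negP nz.
have := max_poly_roots nz (rs := [seq s%:R | s <- iota 0 (size p)]).
rewrite size_map size_iota ltnn => /(_ _ _)/negP; apply; rewrite ?oppbT //.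
  by apply/allP => _ /mapP[s _ ->]; apply/eqP.
by rewrite map_inj_uniq ?iota_uniq //; apply: natr_inj.
Qed.

Lemma iter_add_binomial (N g : 'End(V)) K v s :
    (forall w, g w = w + N w) -> iter K N v = 0 ->
  iter s g v = \sum_(d < K) 'C(s, d)%:R *: iter d N v.
Proof.
move=> gE NK; elim: s => [|s IHs].
  case: K NK => [|K] /=; first by rewrite big_ord0.
  rewrite big_ord_recl bin0 scale1r big1 ?addr0 //= => i _.
  by rewrite bin_small // scale0r.
have -> : \sum_(d < K) 'C(s.+1, d)%:R *: iter d N v =
          \sum_(d < K.+1) 'C(s.+1, d)%:R *: iter d N v.
  by rewrite big_ord_recr /= NK scaler0 addr0.
rewrite iterS gE IHs big_ord_recl /= bin0 scale1r.
have -> : \sum_(d < K) 'C(s, d)%:R *: iter d N v =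
          \sum_(d < K.+1) 'C(s, d)%:R *: iter d N v.
  by rewrite big_ord_recr /= NK scaler0 addr0.
rewrite big_ord_recl /= bin0 scale1r -addrA; congr (_ + _).
rewrite [in X in _ + N X](_ : v + _ = \sum_(d < K.+1) 'C(s, d)%:R *: iter d N v).
  rewrite big_ord_recr /= NK scaler0 addr0 linear_sum -big_split /=.
  apply: eq_bigr => d _; rewrite linearZ /bump /= !add1n binS natrD scalerDl.
  by rewrite add0n.
by rewrite [RHS]big_ord_recl /= bin0 scale1r.
Qed.

(** The powers of a unipotent element g are the values at the natural numbers of
    a polynomial curve, and the natural numbers are dense in the line; this joins
    the identity to g. *)
Lemma connected_unipotent_subgroup H :
  subgroup H -> included H (unipotent (V := V)) -> connected H.
Proof.
move=> [HGL H1 HM HV] uH; apply: (connected_star H1) => g Hg.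
have [K NK] := uH g Hg; pose N := (g - \1)%VF.
have gE w : g w = w + N w by rewrite add_lfunE opp_lfunE id_lfunE addrC subrK.
pose pw d (h : 'End(V)) : 'End(V) := iter d (fun h' => h \o h')%VF \1%VF.
have pwE d h v : pw d h v = iter d h v.
  by elim: d => [|d IHd] /=; rewrite ?id_lfunE // comp_lfunE IHd.
(* B d is the binomial coefficient X (X - 1) ... (X - d + 1) / d! *)
pose B d : {poly k} := (d`!%:R)^-1 *: \prod_(i < d) ('X - i%:R%:P).
have BE d s : (B d).[s%:R] = 'C(s, d)%:R.
  have f0 : d`!%:R != 0 :> k by case: d`! (fact_gt0 d) => // m _; apply: natr_neq0.
  rewrite hornerZ; apply: (mulfI f0); rewrite mulrA mulfV // mul1r.
  rewrite -natrM mulnC bin_ffact.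
  elim: d {f0} => [|d IHd]; first by rewrite big_ord0 hornerC.
  rewrite big_ord_recr /= hornerM IHd !hornerE ffactnSr natrM.
  by case: (leqP d s) => [/natrB->//|/ffact_small->]; rewrite !mul0r.
pose gamma t := \sum_(d < K) (B d).[t] *: pw d N.
have gammaE s : gamma s%:R = pw s g.
  apply/lfunP => v; rewrite sum_lfunE pwE (iter_add_binomial _ gE (NK v)).
  by apply: eq_bigr => d _; rewrite scale_lfunE pwE BE.
exists (fun h => exists2 t, (exists s, t = s%:R) & h = gamma t); split.
- move=> _ [_ [s ->] ->]; rewrite gammaE; elim: s => [|s IHs]; first exact: H1.
  exact: (HM g (pw s g) Hg IHs).
- apply: connected_curve => [p p0|]; first by apply: poly_nat_eq0 => s; apply: p0; exists s.
  apply: polynomial_map_sum => d; apply: polynomial_map_scale (polynomial_map_cst _ _).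
  apply: polynomial_fun_ext (_ : polynomial_fun (fun t : k^o =>
    \sum_(j < size (B d)) (B d)`_j * (t : k) ^+ j)).
    by move=> t; rewrite horner_coef.
  apply: polynomial_sum => j; apply: polynomialM (polynomial_cst _ _) _.
  by apply: polynomialX; apply: polynomial_scalar.
- by exists 0%:R; [exists 0%N | rewrite gammaE].
- by exists 1%:R; [exists 1%N | rewrite gammaE /pw /= comp_lfun1r].
Qed.

End ConnectedGroups.

(** * Homomorphisms of algebraic groups *)

Section AlgebraicHomomorphisms.

Variable k : fieldType.
Implicit Types (U V W : vectType k).

Lemma polynomial_map_pair U V W (F : U -> V) (F' : U -> W) :
  polynomial_map F -> polynomial_map F' -> polynomial_map (fun u => (F u, F' u)).
Proof.
move=> pF pF'; apply: polynomial_map_ext (_ : polynomial_map (fun u =>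
  (F u, 0 : W) + (0 : V, F' u))).
  by move=> u; rewrite /GRing.add /= /add_pair /= addr0 add0r.
apply: polynomial_mapD.
  apply: (@polynomial_map_comp _ _ _ _ (fun v : V => (v, 0 : W))) pF _.
  apply: polynomial_map_linear => c v v'.
  by rewrite /GRing.scale /GRing.add /= /scale_pair /add_pair /= scaler0 addr0.
apply: (@polynomial_map_comp _ _ _ _ (fun w : W => (0 : V, w))) pF' _.
apply: polynomial_map_linear => c v v'.
by rewrite /GRing.scale /GRing.add /= /scale_pair /add_pair /= scaler0 addr0.
Qed.

Lemma polynomial_map_fst V W : polynomial_map (fun u : V * W => u.1).
Proof. by apply: polynomial_map_linear. Qed.

Lemma polynomial_map_snd V W : polynomial_map (fun u : V * W => u.2).
Proof. by apply: polynomial_map_linear. Qed.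

Lemma regular_polynomial_map V W (X : 'End(V) -> Prop) (F : 'End(V) -> 'End(W)) :
  polynomial_map F -> regular_on X F.
Proof.
by move=> pF; exists (fun u => F u.1) => //; apply: polynomial_map_comp pF;
  apply: polynomial_map_fst.
Qed.

Lemma regular_on_sub V W (X X' : 'End(V) -> Prop) (F : 'End(V) -> 'End(W)) :
  included X' X -> regular_on X F -> regular_on X' F.
Proof. by move=> X'X [P pP FP]; exists P => // g /X'X/FP. Qed.

Lemma algebraic_hom_1 V W (H1 : 'End(V) -> Prop) (H2 : 'End(W) -> Prop) F :
  subgroup H1 -> subgroup H2 -> algebraic_hom H1 H2 F -> F \1%VF = \1%VF.
Proof.
move=> [_ H11 _ _] [HGL _ _ _] [_ FH FM].
have := FM _ _ H11 H11; rewrite comp_lfun1l => /(congr1 (comp_lfun (F \1)^-1)%VF).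
by rewrite lker0_compKf ?lker0_compVf //; exact: HGL (FH _ H11).
Qed.

Lemma algebraic_hom_inv V W (H1 : 'End(V) -> Prop) (H2 : 'End(W) -> Prop) F g :
    subgroup H1 -> subgroup H2 -> algebraic_hom H1 H2 F -> H1 g ->
  F (g^-1)%VF = ((F g)^-1)%VF.
Proof.
move=> gH1 gH2 homF Hg; have F1 := algebraic_hom_1 gH1 gH2 homF.
case: homF gH1 => _ _ FM [HGL _ _ HV]; symmetry; apply: inv_unique.
by rewrite -FM ?lker0_compVf //; [apply: HGL | apply: HV].
Qed.

Lemma algebraic_hom_comp U V W (H1 : 'End(U) -> Prop) (H2 : 'End(V) -> Prop)
    (H3 : 'End(W) -> Prop) F F' :
    subgroup H1 -> subgroup H2 ->
    algebraic_hom H1 H2 F -> algebraic_hom H2 H3 F' ->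
  algebraic_hom H1 H3 (F' \o F).
Proof.
move=> gH1 gH2 homF; have FV := algebraic_hom_inv gH1 gH2 homF.
case: homF gH1 => -[P pP FP] FH FM [HGL _ _ HV] [[P' pP' FP'] FH' FM'].
split=> [|g /FH/FH' //|g h Hg Hh]; last by rewrite /= FM // FM' //; apply: FH.
exists (fun u => P' (P (u.1, u.2), P (u.2, u.1))) => [|g Hg /=].
  apply: polynomial_map_comp pP'; apply: polynomial_map_pair;
  apply: polynomial_map_comp pP; apply: polynomial_map_pair;
  by [apply: polynomial_map_fst | apply: polynomial_map_snd].
rewrite (FP' _ (FH g Hg)) -FV // (FP g Hg).
by rewrite (FP (g^-1)%VF) ?invK_GL //; [apply: HGL | apply: HV].
Qed.

Lemma algebraic_iso_trans U V W (H1 : 'End(U) -> Prop) (H2 : 'End(V) -> Prop)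
    (H3 : 'End(W) -> Prop) F F' :
  algebraic_iso_by H1 H2 F -> algebraic_iso_by H2 H3 F' ->
  algebraic_iso_by H1 H3 (F' \o F).
Proof.
move=> [aH1 aH2 homF [E [homE EF FE]]] [_ aH3 homF' [E' [homE' EF' FE']]].
case: (aH1) (aH2) (aH3) => gH1 _ [gH2 _] [gH3 _].
split=> //; first exact: algebraic_hom_comp homF homF'.
exists (E \o E'); split=> [|g Hg|h Hh] /=; first exact: algebraic_hom_comp homE' homE.
  by rewrite EF' ?EF //; case: homF => _ FH _; apply: FH.
by rewrite FE ?FE' //; case: homE' => _ FH _; apply: FH.
Qed.

Lemma algebraic_iso_ext V W (H1 : 'End(V) -> Prop) (H2 : 'End(W) -> Prop) F F' :
    (forall g, H1 g -> F g = F' g) ->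
  algebraic_iso_by H1 H2 F -> algebraic_iso_by H1 H2 F'.
Proof.
move=> FF' [aH1 aH2 [[P pP FP] FH FM] [E [homE EF FE]]].
have [[_ _ HM _] _] := aH1; split=> //.
  split=> [|g Hg|g h Hg Hh]; last by rewrite -!FF' ?FM //; apply: HM.
    by exists P => // g Hg; rewrite -FF' // FP.
  by rewrite -FF' //; apply: FH.
exists E; split=> // [g Hg|h Hh]; first by rewrite -FF' ?EF.
by rewrite -FF' ?FE //; case: homE => _ EH _; apply: EH.
Qed.

Lemma conjugate_iso V (u : 'End(V)) (H : 'End(V) -> Prop) :
    GL V u -> algebraic_group H ->
  algebraic_iso_by (conjugate u H) H (fun g => (u^-1 \o g \o u)%VF).
Proof.
move=> Gu [[HGL H1 HM HV] cH].
have conjE g : conjugate u H g <-> H (u^-1 \o g \o u)%VF.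
  split=> [[h Hh ->]|Hg].
    by rewrite -!comp_lfunA lker0_compKf // lker0_compVf // comp_lfun1r.
  exists (u^-1 \o g \o u)%VF => //.
  by rewrite !comp_lfunA lker0_compfV // comp_lfun1l lker0_compfK.
have conjK g : (u^-1 \o (u \o g \o u^-1) \o u)%VF = g.
  by rewrite -!comp_lfunA lker0_compKf // lker0_compVf // comp_lfun1r.
have conjVK g : (u \o (u^-1 \o g \o u) \o u^-1)%VF = g.
  by rewrite !comp_lfunA lker0_compfV // comp_lfun1l lker0_compfK.
have conjM g h : (u^-1 \o (g \o h) \o u = u^-1 \o g \o u \o (u^-1 \o h \o u))%VF.
  by rewrite !comp_lfunA lker0_compfK.
have conjVM g h : (u \o (g \o h) \o u^-1 = u \o g \o u^-1 \o (u \o h \o u^-1))%VF.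
  by rewrite !comp_lfunA lker0_compfVK.
have linC (a b : 'End(V)) : linear (fun g : 'End(V) => a \o g \o b)%VF.
  move=> c g h; apply/lfunP => v.
  by rewrite !(comp_lfunE, add_lfunE, scale_lfunE) linearP.
have GLE g : GL V g <-> GL V (u^-1 \o g \o u)%VF.
  split=> Gg; first exact: GL_comp (GL_comp (GL_inv Gu) Gg) Gu.
  by rewrite -[g]conjVK; apply: GL_comp (GL_comp Gu Gg) (GL_inv Gu).
split; [split; [split|]|by split| |].
- by move=> g /conjE/HGL; apply: (proj2 (GLE g)).
- by apply/conjE; rewrite comp_lfun1r lker0_compVf.
- by move=> g h /conjE Hg /conjE Hh; apply/conjE; rewrite conjM; apply: HM.
- move=> g /[dup] /conjE Hg [h Hh gE]; apply/conjE.
  have Gh := HGL _ Hh; have GVu := GL_inv Gu; have Guh := GL_comp Gu Gh.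
  rewrite gE !inv_comp // invK_GL //.
  by rewrite (comp_lfunA u) conjK; apply: HV.
- have [S pS defH] := cH.
  exists (fun f => exists2 f', S f' & f = fun g => f' (u^-1 \o g \o u)%VF) => [|g].
    move=> _ [f Sf ->]; apply: polynomial_comp (pS _ Sf).
    exact/polynomial_map_linear/linC.
  rewrite conjE GLE defH; split=> -[Gg fg]; split=> //.
    by move=> _ [f Sf ->]; apply: fg.
  by move=> f Sf; apply: (fg (fun g => f (u^-1 \o g \o u)%VF)); exists f.
- split=> [|g /conjE // | g h _ _]; last exact: conjM.
  exact/regular_polynomial_map/polynomial_map_linear/linC.
exists (fun g => u \o g \o u^-1)%VF; split=> [|g _|g _]; [|exact: conjVK|exact: conjK].
split=> [|g Hg | g h _ _]; last exact: conjVM.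
  exact/regular_polynomial_map/polynomial_map_linear/linC.
by exists g.
Qed.

End AlgebraicHomomorphisms.

(** * Coefficients in the quotient algebra *)

Lemma linfunE_linear (k : fieldType) (V W : vectType k) (f : V -> W) :
  linear f -> linfun f =1 f.
Proof.
move=> linf; pose F := HB.pack_for {linear V -> W} f (GRing.isLinear.Build _ _ _ _ f linf).
exact: (lfunE F).
Qed.

Lemma mnm_ind n (P : 'X_{1..n} -> Prop) :
    P 0%MM -> (forall m i, P m -> P (m + U_(i))%MM) ->
  forall m, P m.
Proof.
move=> P0 PU m; move: {2}(mdeg m) (leqnn (mdeg m)) => d; elim: d m => [|d IHd] m.
  by rewrite leqn0 mdeg_eq0 => /eqP->.
have [/existsP[i mi] md|] := boolP [exists i, 0 < m i]%N.
  have Um : (U_(i) <= m)%MM by rewrite lep1mP -lt0n.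
  rewrite -(submK Um); apply: PU; apply: IHd.
  by move: md; rewrite -{1}(submK Um) mdegD mdeg1 addn1 ltnS.
rewrite negb_exists => /forallP m0 _; suff -> : m = 0%MM by [].
by apply/mnmP => i; rewrite mnm0E; apply/eqP; rewrite -leqn0 leqNgt.
Qed.

Section QuotientCoefficients.

Variables (k : fieldType) (n : nat) (I : cofinite_monomial_ideal k n).
Local Notation A := (quot_alg I).
Local Notation pr := (mod_ideal I).
Local Notation supp := (supp (ideal_pred I)).
Implicit Types (m : 'X_{1..n}) (p q : {mpoly k[n]}) (a b : A) (g h D : 'End(A)).

Lemma pr_mon_eq0 m : (pr 'X_[m] == 0) = (m \in supp).
Proof. by rewrite mod_ideal_eq0. Qed.

Lemma suppD m m' : m \in supp -> (m + m')%MM \in supp.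
Proof.
by rewrite -!pr_mon_eq0 mpolyXD rmorphM /= => /eqP->; rewrite mul0r.
Qed.

Lemma supp0 : 0%MM \notin supp.
Proof. by have := ideal_proper I; rewrite inE mpolyX0. Qed.

Lemma supp_bound (w : 'X_{1..n} -> nat) :
  exists K, forall m, (K <= w m)%N -> m \in supp.
Proof.
exists (\max_(m <- standard_monomials I) w m).+1 => m; apply: contraTT.
rewrite -mem_standard -leqNgt => ms.
by rewrite (big_rem m ms) /= leq_maxl.
Qed.

Lemma pr_expand p : pr p = \sum_(m <- msupp p) p@_m *: pr 'X_[m].
Proof.
by rewrite {1}[p]mpolyE linear_sum; apply: eq_bigr => m _; rewrite linearZ.
Qed.

Lemma lfun_eq_mon (W : vectType k) (f h : 'Hom(A, W)) :
  (forall m, f (pr 'X_[m]) = h (pr 'X_[m])) -> f = h.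
Proof.
move=> fh; apply/lfunP => a; have [p ->] := mod_idealP a.
rewrite pr_expand !linear_sum; apply: eq_bigr => m _.
by rewrite !linearZ /= fh.
Qed.

(** This does not depend on the representative when m lies outside of the
    ideal. *)
Definition mod_coef m a : k := (repr a)@_m.

Lemma mod_coefE m p : m \notin supp -> mod_coef m (pr p) = p@_m.
Proof.
move=> ms; apply/eqP; rewrite -subr_eq0 -mcoeffB; apply/eqP/memN_msupp_eq0.
apply: contra ms; apply: ideal_supp.
by rewrite -mod_ideal_eq0 rmorphB subr_eq0 /= mod_ideal_repr.
Qed.

Lemma mod_coef_linear m : m \notin supp -> scalar (mod_coef m).
Proof.
move=> ms c a b; have [p ->] := mod_idealP a; have [q ->] := mod_idealP b.
by rewrite -linearP !mod_coefE // mcoeffD mcoeffZ.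
Qed.

Definition alg_hom g := {morph g : a b / a * b} /\ g 1 = 1.

Lemma AutE g : Aut I g <-> GL A g /\ alg_hom g.
Proof.
split=> [[Gg /ahom_inP[gM g1]] | [Gg [gM g1]]]; split=> //.
  by split=> // a b; apply: gM; rewrite memvf.
by apply/ahom_inP; split=> // a b _ _; apply: gM.
Qed.

Lemma alg_hom_comp g h : alg_hom g -> alg_hom h -> alg_hom (g \o h)%VF.
Proof.
move=> [gM g1] [hM h1]; split; last by rewrite comp_lfunE h1 g1.
by move=> a b; rewrite !comp_lfunE hM gM.
Qed.

Lemma alg_hom_1 : alg_hom \1%VF.
Proof. by split=> [a b|]; rewrite !id_lfunE. Qed.

Lemma alg_hom_inv g : GL A g -> alg_hom g -> alg_hom (g^-1)%VF.
Proof.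
move=> Gg [gM g1]; split=> [a b|]; apply: (lker0P Gg).
  by rewrite gM !lker0_lfunVK.
by rewrite lker0_lfunVK.
Qed.

Lemma alg_hom_X g m i : alg_hom g ->
  g (pr 'X_[m + U_(i)]) = g (pr 'X_[m]) * g (xbar I i).
Proof. by case=> gM _; rewrite mpolyXD rmorphM gM. Qed.

Lemma pr_X0 : pr 'X_[0] = 1.
Proof. by rewrite mpolyX0 rmorph1. Qed.

Lemma alg_hom_ext g h : alg_hom g -> alg_hom h ->
  (forall i, g (xbar I i) = h (xbar I i)) -> g = h.
Proof.
move=> ag ah gh; apply: lfun_eq_mon; elim/mnm_ind => [|m i IHm].
  by case: ag ah => _ g1 [_ h1]; rewrite pr_X0 g1 h1.
by rewrite !alg_hom_X // IHm gh.
Qed.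

Lemma Aut_subgroup : subgroup (Aut I).
Proof.
split=> [g /AutE[]//||g h|g].
- by apply/AutE; split; [apply: GL_1 | apply: alg_hom_1].
- move=> /AutE[Gg ag] /AutE[Gh ah]; apply/AutE.
  by split; [apply: GL_comp | apply: alg_hom_comp].
move=> /AutE[Gg ag]; apply/AutE.
by split; [apply: GL_inv | apply: alg_hom_inv].
Qed.

Lemma induced_endomorphism (d : {linear {mpoly k[n]} -> {mpoly k[n]}}) :
    (forall p, p \in ideal_pred I -> d p \in ideal_pred I) ->
  exists D : 'End(A), forall p, D (pr p) = pr (d p).
Proof.
move=> dI; pose f a := pr (d (repr a)).
have fE p : f (pr p) = pr (d p).
  apply/eqP; rewrite /f -subr_eq0 -rmorphB -linearB mod_ideal_eq0.
  apply: dI; rewrite -mod_ideal_eq0 rmorphB subr_eq0.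
  by rewrite /= mod_ideal_repr.
exists (linfun f) => p; rewrite linfunE_linear // => c a b.
have [p1 ->] := mod_idealP a; have [p2 ->] := mod_idealP b.
by rewrite -linearP !fE !linearP.
Qed.

Lemma idealZX p : (forall m, m \in msupp p -> m \in supp) -> p \in ideal_pred I.
Proof. by move=> pI; rewrite mem_ideal; apply/allP. Qed.

(** * The preorder on the variables *)

(** In characteristic zero this says that x_i d/dx_j preserves the ideal, that
    is, replacing one factor x_j of a monomial of the ideal by x_i never leaves
    it.  It is enough to test the products of the standard monomials by x_j,
    since m x_i lies in the ideal as soon as m does. *)
Definition below (i j : 'I_n) :=
  all (fun m => ((m + U_(j))%MM \in supp) ==> ((m + U_(i))%MM \in supp))
    (standard_monomials I).

Lemma belowP i j :
  reflect (forall m, (m + U_(j))%MM \in supp -> (m + U_(i))%MM \in supp) (below i j).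
Proof.
apply: (iffP allP) => [bij m ms | bij m _]; last exact/implyP/bij.
have [/suppD//|] := boolP (m \in supp).
by rewrite -mem_standard => /bij/implyP/(_ ms).
Qed.

Lemma below_refl i : below i i.
Proof. exact/belowP. Qed.

Lemma below_trans j i l : below i j -> below j l -> below i l.
Proof. by move=> /belowP bij /belowP bjl; apply/belowP => m /bjl/bij. Qed.

Definition equivalent i j := below i j && below j i.

Definition strictly_below i j := below i j && ~~ below j i.

Lemma equivalent_refl i : equivalent i i.
Proof. by rewrite /equivalent below_refl. Qed.

Lemma equivalent_sym i j : equivalent i j = equivalent j i.
Proof. by rewrite /equivalent andbC. Qed.

Lemma equivalent_trans j i l : equivalent i j -> equivalent j l -> equivalent i l.
Proof.
move=> /andP[ij ji] /andP[jl lj].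
by rewrite /equivalent (below_trans ij jl) (below_trans lj ji).
Qed.

Lemma below_split i j : below i j = equivalent i j || strictly_below i j.
Proof. by rewrite /equivalent /strictly_below; case: (below i j); case: (below j i). Qed.

Lemma strictly_below_not_equivalent i j : strictly_below i j -> equivalent i j = false.
Proof. by rewrite /equivalent => /andP[-> /negPf->]. Qed.

Lemma below_strictly_below_trans j i l :
  below i j -> strictly_below j l -> strictly_below i l.
Proof.
move=> ij /andP[jl lj]; rewrite /strictly_below (below_trans ij jl).
by apply: contra lj => li; apply: below_trans li ij.
Qed.

Lemma strictly_below_below_trans j i l :
  strictly_below i j -> below j l -> strictly_below i l.
Proof.
move=> /andP[ij ji] jl; rewrite /strictly_below (below_trans ij jl).
by apply: contra ji => li; apply: below_trans jl li.
Qed.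

Lemma derivation_1 D : derivation D -> D 1 = 0.
Proof.
move=> DM; have := DM 1 1; rewrite !(mulr1, mul1r) => /eqP.
by rewrite -subr_eq0 opprD addNKr oppr_eq0 => /eqP.
Qed.

Lemma derivation_chain D p : derivation D ->
  D (pr p) = \sum_l pr (p^`M(l)) * D (xbar I l).
Proof.
move=> DM; have DX m : D (pr 'X_[m]) = \sum_l pr ('X_[m]^`M(l)) * D (xbar I l).
  elim/mnm_ind: m => [|m i IHm].
    rewrite pr_X0 derivation_1 // big1 // => l _.
    by rewrite mpolyX0 -mpolyC1 mderivC rmorph0 mul0r.
  rewrite mpolyXD rmorphM DM IHm.
  under [RHS]eq_bigr do rewrite mderivM rmorphD !rmorphM mulrDl mulrAC.
  rewrite big_split -mulr_suml; congr (_ + _).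
  rewrite (bigD1 i) //= big1 ?addr0 => [|l li]; rewrite mderivX mnm1E.
    by rewrite eqxx scale1r -[X in (X - _)%MM]add0m addmK mpolyX0 rmorph1 mulr1.
  by rewrite eq_sym (negPf li) scale0r rmorph0 mulr0 mul0r.
rewrite pr_expand linear_sum; under eq_bigr do rewrite linearZ /= DX scaler_sumr.
rewrite exchange_big; apply: eq_bigr => l _ /=.
rewrite [p in RHS]mpolyE (linear_sum (mderiv l)) linear_sum /= mulr_suml.
apply: eq_bigr => m _.
by rewrite linearZ /= linearZ -scalerAl.
Qed.

End QuotientCoefficients.

Section LinearPart.

Variables (k : fieldType) (n : nat) (I : cofinite_monomial_ideal k n).
Hypothesis char0 : [pchar k] =i pred0.
Hypothesis var_notin_I : forall i : 'I_n, 'X_i \notin (I : {pred {mpoly k[n]}}).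
Local Notation A := (quot_alg I).
Local Notation pr := (mod_ideal I).
Local Notation supp := (supp (ideal_pred I)).
Implicit Types (m : 'X_{1..n}) (p q : {mpoly k[n]}) (a b : A) (g h D : 'End(A)).

(** * Linear parts of algebra endomorphisms *)

Lemma supp_var i : U_(i)%MM \notin supp.
Proof. exact: var_notin_I. Qed.

Definition const_coef a := mod_coef 0%MM a.
Definition lin_coef i a := mod_coef U_(i)%MM a.

Lemma const_coefE p : const_coef (pr p) = p@_0%MM.
Proof. by rewrite /const_coef mod_coefE ?supp0. Qed.

Lemma lin_coefE i p : lin_coef i (pr p) = p@_U_(i).
Proof. by rewrite /lin_coef mod_coefE ?supp_var. Qed.

Lemma const_coef_linear : scalar const_coef.
Proof. exact/mod_coef_linear/supp0. Qed.

Lemma lin_coef_linear i : scalar (lin_coef i).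
Proof. exact/mod_coef_linear/supp_var. Qed.

HB.instance Definition _ :=
  GRing.isLinear.Build k A k _ const_coef const_coef_linear.
HB.instance Definition _ i :=
  GRing.isLinear.Build k A k _ (lin_coef i) (lin_coef_linear i).

Lemma const_coefM a b : const_coef (a * b) = const_coef a * const_coef b.
Proof.
have [p ->] := mod_idealP a; have [q ->] := mod_idealP b.
by rewrite -rmorphM !const_coefE rmorphM.
Qed.

Lemma const_coef1 : const_coef 1 = 1.
Proof. by rewrite -(rmorph1 pr) const_coefE mcoeff1 eqxx. Qed.

Lemma const_coefX a d : const_coef (a ^+ d) = const_coef a ^+ d.
Proof.
by elim: d => [|d IHd]; rewrite ?const_coef1 // !exprS const_coefM IHd.
Qed.

Lemma mcoeffU_deriv i p : p@_U_(i) = (p^`M(i))@_0%MM.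
Proof. by rewrite mcoeff_deriv add0m mnm0E. Qed.

Lemma lin_coefM i a b :
  lin_coef i (a * b) = lin_coef i a * const_coef b + const_coef a * lin_coef i b.
Proof.
have [p ->] := mod_idealP a; have [q ->] := mod_idealP b.
rewrite -rmorphM !const_coefE !lin_coefE !mcoeffU_deriv mderivM mcoeffD.
by rewrite !rmorphM.
Qed.

Lemma lin_coef1 i : lin_coef i 1 = 0.
Proof. by rewrite -(rmorph1 pr) lin_coefE mcoeff1 mnm1_eq0. Qed.

Lemma const_coef_xbar i : const_coef (xbar I i) = 0.
Proof. by rewrite const_coefE mcoeffX mnm1_eq0. Qed.

Lemma lin_coef_xbar i j : lin_coef i (xbar I j) = (i == j)%:R.
Proof. by rewrite lin_coefE mcoeffXU eq_sym. Qed.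

Definition lin g : 'M[k]_n := \matrix_(i, j) lin_coef i (g (xbar I j)).

Lemma const_coef_alg_hom g a : alg_hom g -> const_coef (g a) = const_coef a.
Proof.
move=> ag; case: (ag) => gM g1.
have gx i : const_coef (g (xbar I i)) = 0.
  have [K big] := supp_bound I (fun m => mdeg m).
  apply/eqP; suff: const_coef (g (xbar I i)) ^+ K.+1 == 0 by rewrite expf_eq0 => /andP[].
  have gX d : g (xbar I i) ^+ d = g (xbar I i ^+ d).
    by elim: d => [|d IHd]; rewrite ?g1 // !exprS gM IHd.
  have xK : xbar I i ^+ K.+1 = 0.
    apply/eqP; rewrite /xbar -rmorphXn /= mpolyXn pr_mon_eq0.
    by rewrite big // mdegMn mdeg1 mul1n.
  by rewrite -const_coefX gX xK !linear0.
have [p ->] := mod_idealP a; rewrite pr_expand !linear_sum.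
apply: eq_bigr => m _; rewrite !linearZ /=; congr (_ * _).
elim/mnm_ind: m => [|m i IHm]; first by rewrite pr_X0 g1.
by rewrite alg_hom_X // mpolyXD rmorphM !const_coefM gx const_coef_xbar !mulr0.
Qed.

Lemma lin_coef_alg_hom g i a : alg_hom g ->
  lin_coef i (g a) = \sum_j lin g i j * lin_coef j a.
Proof.
move=> ag; case: (ag) => gM g1.
have [p ->] := mod_idealP a; rewrite pr_expand !linear_sum /=.
under [RHS]eq_bigr => j do rewrite linear_sum mulr_sumr.
rewrite exchange_big; apply: eq_bigr => m _ /=; rewrite !linearZ /=.
under eq_bigr do rewrite linearZ /= mulrCA; rewrite -mulr_sumr; congr (_ * _).
elim/mnm_ind: m => [|m l _].
  rewrite pr_X0 g1 lin_coef1 big1 // => j _.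
  by rewrite lin_coef1 mulr0.
rewrite alg_hom_X // lin_coefM !const_coef_alg_hom // const_coef_xbar mulr0 add0r.
under eq_bigr do rewrite mpolyXD rmorphM lin_coefM const_coef_xbar mulr0 add0r.
rewrite (bigD1 l) //= big1 ?addr0 => [|j jl].
  by rewrite lin_coef_xbar eqxx mulr1 mxE mulrC.
by rewrite lin_coef_xbar (negPf jl) !mulr0.
Qed.

Lemma lin_comp g h : alg_hom g -> lin (g \o h)%VF = lin g *m lin h.
Proof.
move=> ag; apply/matrixP => i j; rewrite !mxE comp_lfunE lin_coef_alg_hom //.
by apply: eq_bigr => l _; rewrite [lin h l j]mxE.
Qed.

Lemma lin_1 : lin \1%VF = 1%:M.
Proof. by apply/matrixP => i j; rewrite !mxE id_lfunE lin_coef_xbar. Qed.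

Lemma lin_mulmxV g : Aut I g -> lin g *m lin (g^-1)%VF = 1%:M.
Proof. by move=> /AutE[Gg ag]; rewrite -lin_comp // lker0_compfV // lin_1. Qed.

Lemma lin_mulVmx g : Aut I g -> lin (g^-1)%VF *m lin g = 1%:M.
Proof. by move/lin_mulmxV/mulmx1C. Qed.

Lemma lin_unit g : Aut I g -> lin g \in unitmx.
Proof. by move/lin_mulmxV/mulmx1_unit => []. Qed.

(** * Derivations and the preorder *)

(** Let x^m x_j belong to the ideal.  In the derivative of this monomial,
    x^m x_i can only come from the factors x_j, and its coefficient is
    (m_j + 1) c, where c is the coefficient of x_i in D x_j.  As the ideal is
    monomial, x^m x_i belongs to it. *)
Lemma derivation_below D i j :
  derivation D -> lin_coef i (D (xbar I j)) != 0 -> below I i j.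
Proof.
move=> DM cij; have [->|ij] := eqVneq i j; first exact: below_refl.
apply/belowP => m; rewrite -pr_mon_eq0 => /eqP m0.
pose q l := repr (D (xbar I l)).
pose P := \sum_l 'X_[m + U_(j)]^`M(l) * q l.
have PI : P \in ideal_pred I.
  rewrite -mod_ideal_eq0 /P rmorph_sum /=; under eq_bigr do rewrite rmorphM /= mod_ideal_repr.
  by rewrite -derivation_chain // m0 linear0.
apply: (ideal_supp PI); rewrite mcoeff_msupp /P (bigD1 j) //= mcoeffD.
have -> : (\sum_(l < n | l != j) 'X_[m + U_(j)]^`M(l) * q l)@_(m + U_(i)) = 0.
  rewrite linear_sum /= big1 // => l lj.
  rewrite mderivX -scalerAl mcoeffZ.
  apply/eqP; rewrite mulf_eq0 mcoeff_eq0; apply/orP; right.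
  rewrite mulrC (perm_mem (msuppMX _ _)); apply/negP => /mapP[m' _].
  move/mnmP/(_ j); rewrite !(mnmDE, mnmBE, mnm1E) eqxx (negPf lj) (negPf ij).
  by rewrite subn0 addn0 addn1 addSn => e; have := leq_addr (m' j) (m j); rewrite -ltnS -e ltnn.
rewrite addr0 mderivX -scalerAl mcoeffZ addmK mulrC.
rewrite [_ * q j]mulrC mcoeffMX mulf_neq0 //.
by rewrite mnmDE mnm1E eqxx addn1 natr_neq0.
Qed.

Lemma mul_var_deriv i j : below I i j ->
  exists D, [/\ forall p, D (pr p) = pr ('X_i * p^`M(j)), derivation D &
    forall l a, lin_coef l (D a) = (l == i)%:R * lin_coef j a].
Proof.
move=> bij; have dlin : linear (fun p => 'X_i * p^`M(j) : {mpoly k[n]}).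
  by move=> c p q; rewrite linearP mulrDr scalerAr.
pose d : {linear {mpoly k[n]} -> {mpoly k[n]}} :=
  HB.pack (fun p : {mpoly k[n]} => 'X_i * p^`M(j)) (GRing.isLinear.Build _ _ _ _ _ dlin).
have [p pI|D DE] := @induced_endomorphism _ _ I d.
  rewrite -mod_ideal_eq0 /= [p]mpolyE linear_sum mulr_sumr rmorph_sum /=.
  rewrite big_seq big1 // => m /(ideal_supp pI) ms.
  rewrite linearZ /= -scalerAr linearZ mderivX -scalerAr linearZ /=.
  have [mj|mj] := posnP (m j); first by rewrite mj scale0r scaler0.
  have Um : (U_(j) <= m)%MM by rewrite lep1mP -lt0n.
  rewrite -mpolyXD addmC.
  have /eqP-> : pr 'X_[(m - U_(j) + U_(i))] == 0.
    by rewrite pr_mon_eq0; apply: (belowP _ _ _ bij); rewrite submK.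
  by rewrite !scaler0.
exists D; split=> //.
  move=> a b; have [p ->] := mod_idealP a; have [q ->] := mod_idealP b.
  rewrite -rmorphM !DE /= mderivM mulrDr rmorphD -!rmorphM.
  by congr (pr _ + pr _); rewrite !mulrA // (mulrC p).
move=> l a; have [p ->] := mod_idealP a.
rewrite DE /= rmorphM lin_coefM const_coef_xbar mul0r addr0 lin_coef_xbar const_coefE.
by rewrite lin_coefE -mcoeffU_deriv.
Qed.

(** Let M = lin g.  Conjugating x_i d/dx_j by g gives a derivation whose linear
    part has the entries (M^-1)_li M_jr; since the preorder knows the linear parts of all
    derivations, the automorphisms normalize it in this entrywise sense. *)
Lemma lin_normalizes_below g i j l r : Aut I g -> below I i j ->
  lin (g^-1)%VF l i != 0 -> lin g j r != 0 -> below I l r.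
Proof.
move=> /[dup] Ag /AutE[Gg ag] /mul_var_deriv[D [_ DM Dlin]] cl cm.
have agV := alg_hom_inv Gg ag; have [gM _] := ag; have [gVM _] := agV.
pose E := (g^-1 \o D \o g)%VF.
have EM : derivation E.
  by move=> a b; rewrite !comp_lfunE gM DM linearD /= !gVM !lker0_lfunK.
apply: (derivation_below EM); rewrite !comp_lfunE lin_coef_alg_hom //.
rewrite (bigD1 i) //= Dlin eqxx mul1r big1 => [|l' li'].
  by rewrite addr0 mulf_neq0 //; move: cm; rewrite mxE.
by rewrite Dlin (negPf li') mul0r mulr0.
Qed.

End LinearPart.

(** * Linear substitutions *)

(** For dimension reasons an invertible matrix maps a stable coordinate subspace
    onto itself. *)
Lemma invmx_stable (F : fieldType) n (V : pred 'I_n) (M : 'M[F]_n) :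
    M \in unitmx -> (forall i j, V j -> ~~ V i -> M i j = 0) ->
  forall i j, V j -> ~~ V i -> invmx M i j = 0.
Proof.
move=> uM MV; pose U : 'M[F]_n := diag_mx (\row_i (V i)%:R).
have UE (N : 'M[F]_n) i j : (N *m U) i j = N i j * (V j)%:R.
  by rewrite mul_mx_diag !mxE.
have UE' (N : 'M[F]_n) i j : (U *m N) i j = (V i)%:R * N i j.
  by rewrite mul_diag_mx !mxE.
have UM : (U *m M^T <= U)%MS.
  suff -> : U *m M^T = (U *m M^T) *m U by apply: submxMl.
  apply/matrixP => i j; rewrite UE !UE' mxE.
  case Vi: (V i); last by rewrite !mul0r.
  by case Vj: (V j); rewrite ?mulr1 // MV ?Vj // !mulr0.
have UM' : (U <= U *m M^T)%MS.
  rewrite -(geq_leqif (mxrank_leqif_sup UM)) mxrankMfree // row_free_unit.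
  by rewrite unitmx_tr.
move=> i j Vj Vi; have /submxP[D] : (U *m (invmx M)^T <= U)%MS.
  rewrite (submx_trans (submxMr _ UM')) // -mulmxA -trmx_mul mulVmx //.
  by rewrite trmx1 mulmx1.
move/matrixP/(_ j i); rewrite UE' UE mxE Vj (negPf Vi) mul1r mulr0.
exact.
Qed.

Lemma mulmx_neq0 (F : fieldType) (m n p : nat) (M : 'M[F]_(m, n)) (N : 'M[F]_(n, p)) i j :
  (M *m N) i j != 0 -> exists l, M i l != 0 /\ N l j != 0.
Proof.
rewrite mxE => nz.
have [l /andP[Mil Nlj]|none] := pickP (fun l => (M i l != 0) && (N l j != 0)).
  by exists l.
case/eqP: nz; apply: big1 => l _; apply/eqP.
by have := none l; rewrite mulf_eq0 /=; do 2!case: eqP.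
Qed.

Section LinearSubstitution.

Variables (k : fieldType) (n : nat) (I : cofinite_monomial_ideal k n).
Hypothesis char0 : [pchar k] =i pred0.
Hypothesis var_notin_I : forall i : 'I_n, 'X_i \notin (I : {pred {mpoly k[n]}}).
Local Notation A := (quot_alg I).
Local Notation pr := (mod_ideal I).
Local Notation supp := (supp (ideal_pred I)).
Implicit Types (m : 'X_{1..n}) (p q : {mpoly k[n]}) (a b : A) (g h D : 'End(A)).
Implicit Types (M N B : 'M[k]_n).

Definition restrict (r : rel 'I_n) M : 'M[k]_n :=
  \matrix_(i, j) if r i j then M i j else 0.

Lemma restrict_id (r : rel 'I_n) M :
  (forall i j, M i j != 0 -> r i j) -> restrict r M = M.
Proof.
move=> Mr; apply/matrixP => i j; rewrite mxE; case: ifP => // nr.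
by apply/esym/eqP; apply: contraFT nr => /Mr.
Qed.

Lemma restrict_linear r : linear (restrict r).
Proof.
move=> c M N; apply/matrixP => i j; rewrite !mxE.
by case: ifP => _; rewrite ?mulr0 ?addr0.
Qed.

(** These matrices form the incidence algebra of the preorder; they are the
    combinations of the linear derivations x_i d/dx_j preserving the ideal. *)
Definition upper M := forall i j, M i j != 0 -> below I i j.

(** The entries outside of the preorder are discarded so that every matrix acts
    on the quotient and linear_subst is a polynomial map defined everywhere. *)
Definition subst_var M j : {mpoly k[n]} :=
  \sum_i restrict (below I) M i j *: 'X_i.

Definition subst M p : {mpoly k[n]} := p \mPo [tuple subst_var M j | j < n].

Lemma subst_is_linear M : linear (subst M).
Proof. by move=> c p q; rewrite /subst linearP. Qed.

HB.instance Definition _ M := GRing.isLinear.Build k _ _ _ (subst M) (subst_is_linear M).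

Lemma subst1 M : subst M 1 = 1.
Proof. exact: rmorph1. Qed.

Lemma substM M p q : subst M (p * q) = subst M p * subst M q.
Proof. exact: rmorphM. Qed.

Lemma substU M j : subst M 'X_j = subst_var M j.
Proof. by rewrite /subst comp_mpolyXU -tnth_nth tnth_mktuple. Qed.

(** The factors of a monomial of the ideal may be replaced one after the
    other. *)
Lemma subst_ideal M p : p \in ideal_pred I -> subst M p \in ideal_pred I.
Proof.
have monI m1 m2 : (m1 + m2)%MM \in supp -> pr (subst M 'X_[m1] * 'X_[m2]) = 0.
  elim/mnm_ind: m1 m2 => [|m1 j IHm] m2.
    by rewrite add0m mpolyX0 subst1 mul1r -pr_mon_eq0 => /eqP.
  move=> ms; rewrite mpolyXD substM substU -mulrA.
  move: (subst M 'X_[m1]) IHm => s IHm; rewrite mulr_suml mulr_sumr.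
  rewrite linear_sum big1 //= => i _; rewrite mxE; case: ifP => bij; last first.
    by rewrite scale0r mul0r mulr0 linear0.
  rewrite -scalerAl -scalerAr linearZ /= -mpolyXD IHm ?scaler0 //.
  have assoc l : (m1 + (U_(l) + m2) = m1 + m2 + U_(l))%MM.
    by apply/mnmP => l'; rewrite !mnmDE addnA addnAC.
  by rewrite assoc; apply: (belowP _ _ _ bij); rewrite -assoc addmA.
move=> pI; rewrite -mod_ideal_eq0 [p]mpolyE (linear_sum (subst M)) linear_sum.
rewrite big_seq big1 //= => m mp; rewrite (linearZ_LR (subst M)) linearZ /=.
have := monI m 0%MM; rewrite addm0 mpolyX0 mulr1 => ->; first by rewrite scaler0.
exact: ideal_supp mp.
Qed.

Definition linear_subst M : 'End(A) := linfun (fun a => pr (subst M (repr a))).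

Lemma linear_substE M p : linear_subst M (pr p) = pr (subst M p).
Proof.
have [D DE] := induced_endomorphism (@subst_ideal M).
suff fD a : pr (subst M (repr a)) = D a.
  rewrite /linear_subst linfunE_linear; first by rewrite fD DE.
  by move=> c a b; rewrite !fD linearP.
by rewrite -[in RHS](mod_ideal_repr a) DE.
Qed.

Lemma alg_hom_linear_subst M : alg_hom (linear_subst M).
Proof.
split=> [a b|]; last by rewrite -(rmorph1 pr) linear_substE subst1.
have [p ->] := mod_idealP a; have [q ->] := mod_idealP b.
by rewrite -rmorphM !linear_substE substM rmorphM.
Qed.

Lemma linear_subst_xbar M j :
  linear_subst M (xbar I j) = \sum_i restrict (below I) M i j *: xbar I i.
Proof.
rewrite linear_substE substU linear_sum; apply: eq_bigr => i _.
by rewrite linearZ.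
Qed.

Lemma lin_linear_subst M : lin (linear_subst M) = restrict (below I) M.
Proof.
apply/matrixP => i j; rewrite mxE linear_subst_xbar linear_sum (bigD1 i) //=.
rewrite linearZ /= lin_coef_xbar // eqxx mulr1 big1 ?addr0 // => l li.
by rewrite linearZ /= lin_coef_xbar // eq_sym (negPf li) mulr0.
Qed.

Lemma lin_linear_subst_upper M : upper M -> lin (linear_subst M) = M.
Proof. by move=> uM; rewrite lin_linear_subst restrict_id. Qed.

Lemma upperM M N : upper M -> upper N -> upper (M *m N).
Proof.
move=> uM uN i j /mulmx_neq0[l [/uM il /uN lj]].
exact: below_trans il lj.
Qed.

Lemma upper1 : upper 1%:M.
Proof.
by move=> i j; rewrite mxE; case: (eqVneq i j) => [-> _|]; rewrite ?below_refl ?eqxx.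
Qed.

Lemma upperD M N : upper M -> upper N -> upper (M + N).
Proof.
move=> uM uN i j; rewrite mxE; apply: contraNT => nij.
have /eqP-> : M i j == 0 by apply: contraNT nij; apply: uM.
by rewrite add0r; apply: contraNT nij; apply: uN.
Qed.

Lemma upperZ c M : upper M -> upper (c *: M).
Proof. by move=> uM i j; rewrite mxE mulf_eq0 negb_or => /andP[_ /uM]. Qed.

Lemma upper_restrict (r : rel 'I_n) M : (forall i j, r i j -> below I i j) -> upper (restrict r M).
Proof. by move=> rb i j; rewrite mxE; case: ifP => [/rb|_ /eqP]. Qed.

Lemma upper_stable M : upper M <->
  forall l i j, below I j l -> ~~ below I i l -> M i j = 0.
Proof.
split=> [uM l i j jl il | stM i j].
  by apply/eqP; apply: contraNT il => /uM ij; apply: below_trans ij jl.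
by apply: contraNT => /(stM j i j (below_refl I j))->.
Qed.

Lemma upper_invmx M : M \in unitmx -> upper M -> upper (invmx M).
Proof.
move=> unitM /upper_stable uM; apply/upper_stable => l.
by apply: (invmx_stable (V := fun j => below I j l)) => // i j; apply: uM.
Qed.

Lemma linear_subst_comp M N : upper M -> upper N ->
  (linear_subst M \o linear_subst N)%VF = linear_subst (M *m N).
Proof.
move=> uM uN; apply: alg_hom_ext => [||j]; last 1 first.
- rewrite comp_lfunE !linear_subst_xbar (restrict_id uN) (restrict_id (upperM uM uN)).
  rewrite linear_sum; under eq_bigr do rewrite linearZ /= linear_subst_xbar scaler_sumr.
  rewrite exchange_big (restrict_id uM) /=; apply: eq_bigr => i _.
  by rewrite mxE scaler_suml; apply: eq_bigr => l _; rewrite scalerA mulrC.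
- by apply: alg_hom_comp; apply: alg_hom_linear_subst.
exact: alg_hom_linear_subst.
Qed.

Lemma linear_subst1 : linear_subst 1%:M = \1%VF.
Proof.
apply: alg_hom_ext => [||j]; [exact: alg_hom_linear_subst|exact: alg_hom_1|].
rewrite id_lfunE linear_subst_xbar restrict_id; last exact: upper1.
rewrite (bigD1 j) //= mxE eqxx scale1r big1 ?addr0 // => i /negPf ij.
by rewrite mxE ij scale0r.
Qed.

Lemma linear_subst_Aut M : M \in unitmx -> upper M -> Aut I (linear_subst M).
Proof.
move=> unitM uM; apply/AutE; split; last exact: alg_hom_linear_subst.
apply: (@GL_left_inv _ _ _ (linear_subst (invmx M))).
by rewrite linear_subst_comp ?mulVmx ?linear_subst1 //; exact: upper_invmx.
Qed.

Lemma linear_subst_inv M : M \in unitmx -> upper M ->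
  (linear_subst M)^-1%VF = linear_subst (invmx M).
Proof.
move=> unitM uM; apply: inv_unique; rewrite linear_subst_comp ?mulVmx ?linear_subst1 //.
exact: upper_invmx.
Qed.

Lemma polynomial_linear_subst : polynomial_map linear_subst.
Proof.
apply: polynomial_map_Hom => a; have [p ->] := mod_idealP a.
apply: polynomial_map_ext (_ : polynomial_map (fun M =>
    \sum_(m <- msupp p) p@_m *: pr (subst M 'X_[m]))).
  move=> M; rewrite pr_expand linear_sum; apply: eq_bigr => m _.
  by rewrite linearZ /= linear_substE.
apply: polynomial_map_sum => m; apply: polynomial_map_scale; first exact: polynomial_cst.
elim/mnm_ind: m => [|m j IHm].
  apply: polynomial_map_ext (polynomial_map_cst _ 1) => M.
  by rewrite mpolyX0 subst1 rmorph1.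
apply: polynomial_map_ext (polynomial_map_mul IHm (_ : polynomial_map (fun M =>
  pr (subst_var M j)))).
  by move=> M; rewrite mpolyXD substM substU rmorphM.
apply: polynomial_map_linear => c M N.
rewrite -linearP; congr (pr _); rewrite /subst_var scaler_sumr -big_split.
by apply: eq_bigr => i _; rewrite restrict_linear !mxE scalerDl scalerA.
Qed.

Lemma lin_linear : linear (@lin k n I).
Proof.
by move=> c g h; apply/matrixP => i j; rewrite !mxE add_lfunE scale_lfunE linearP.
Qed.

Lemma polynomial_lin_entry i j : polynomial_fun (fun g => lin g i j).
Proof. by apply: polynomial_scalar => c g h; rewrite lin_linear !mxE. Qed.

(** The segment from 1 to M, deprived of the zeros of the determinant, joins
    linear_subst M to the identity inside the automorphism group. *)
Lemma linear_subst_neutral M : M \in unitmx -> upper M ->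
  neutral_component (Aut I) (linear_subst M).
Proof.
move=> unitM uM; pose seg t := 1%:M + t *: (M - 1%:M).
have useg t : upper (seg t).
  by apply: upperD upper1 _; apply: upperZ; apply: upperD uM _;
    rewrite -scaleN1r; apply: upperZ upper1.
pose segX : 'M[{poly k}]_n := map_mx polyC 1%:M + 'X *: map_mx polyC (M - 1%:M).
have detE t : (\det segX).[t] = \det (seg t).
  rewrite -/(horner_eval t _) -det_map_mx; congr (\det _).
  apply/matrixP => i j; rewrite !mxE /= /horner_eval.
  by rewrite hornerD hornerM hornerX !hornerC.
exists (fun g => exists2 t, seg t \in unitmx & g = linear_subst (seg t)); split.
- by move=> _ [t ut ->]; apply: linear_subst_Aut.
- apply: connected_curve => [p p0|]; last first.
    apply: (polynomial_map_comp (F' := seg : k^o -> 'M[k]_n)) polynomial_linear_subst.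
    apply: polynomial_mapD; first exact: polynomial_map_cst.
    apply: polynomial_map_scale (polynomial_map_cst _ _).
    exact: polynomial_scalar.
  have : p * \det segX = 0.
    apply: (poly_nat_eq0 char0) => s; rewrite hornerM detE.
    case: (boolP (seg s%:R \in unitmx)) => [/p0->|]; first by rewrite mul0r.
    by rewrite unitmxE unitfE negbK => /eqP->; rewrite mulr0.
  move/eqP; rewrite mulf_eq0 => /orP[/eqP//|/eqP det0].
  by have := detE 0; rewrite det0 horner0 /seg scale0r addr0 det1 => /eqP; rewrite eq_sym oner_eq0.
- exists 0; first by rewrite /seg scale0r addr0 unitmx1.
  by rewrite /seg scale0r addr0 linear_subst1.
by exists 1; rewrite /seg scale1r addrC subrK.
Qed.

End LinearSubstitution.

(** * The neutral component *)

Section NeutralComponent.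

Variables (k : fieldType) (n : nat) (I : cofinite_monomial_ideal k n).
Hypothesis char0 : [pchar k] =i pred0.
Hypothesis var_notin_I : forall i : 'I_n, 'X_i \notin (I : {pred {mpoly k[n]}}).
Local Notation A := (quot_alg I).
Local Notation pr := (mod_ideal I).
Local Notation supp := (supp (ideal_pred I)).
Local Notation upper := (upper I).
Implicit Types (m : 'X_{1..n}) (p q : {mpoly k[n]}) (a b : A) (g h D : 'End(A)).
Implicit Types (M N X : 'M[k]_n).

Lemma lin_inv g : Aut I g -> lin (g^-1)%VF = invmx (lin g).
Proof.
move=> Ag; have := lin_mulVmx var_notin_I Ag.
move/(congr1 (mulmx^~ (invmx (lin g)))); rewrite mul1mx -mulmxA mulmxV ?mulmx1 //.
exact: lin_unit.
Qed.

(** Let V be spanned by the x_j with j below l, and M = lin g.  By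
    lin_normalizes_below the matrix M maps V onto a coordinate subspace.  So
    either M V = V or M V misses a coordinate of V; these are two disjoint closed
    conditions on g, and the first one holds at the identity. *)
Lemma neutral_upper g :
  neutral_component (Aut I) g -> Aut I g /\ upper (lin g).
Proof.
move=> [C [CA cC C1 Cg]]; split; first exact: CA.
apply/upper_stable => l.
pose V j := below I j l.
pose Y h := GL A h /\ forall ij, (if V ij.2 && ~~ V ij.1 then lin h ij.1 ij.2 else 0) = 0.
pose Z0 c h := GL A h /\ forall j, (if V j then lin h c j else 0) = 0.
pose Z h := exists2 c, c \in [seq c <- enum 'I_n | V c] & Z0 c h.
have YP h : Y h -> forall i j, V j -> ~~ V i -> lin h i j = 0.
  by move=> [_ hV] i j Vj Vi; have := hV (i, j); rewrite Vj Vi.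
have cY : zariski_closed Y.
  apply: closed_equations => ij.
  case: (V ij.2 && _); last exact: polynomial_cst.
  exact: polynomial_lin_entry.
have cZ : zariski_closed Z.
  apply: closed_ex_seq => c; apply: closed_equations => j.
  by case: (V j); [apply: polynomial_lin_entry | apply: polynomial_cst].
have YZ h : C h -> Y h -> Z h -> False.
  move=> /CA Ah /YP hV [c]; rewrite mem_filter => /andP[Vb _] [_ hc].
  have hVV := invmx_stable (lin_unit var_notin_I Ah) hV.
  have /matrixP/(_ c c) := lin_mulmxV var_notin_I Ah; rewrite lin_inv // !mxE eqxx.
  rewrite big1 => [/eqP|j _]; first by rewrite eq_sym oner_eq0.
  have := hc j; case: (boolP (V j)) => [_ ->|Vj _]; first by rewrite mul0r.
  by rewrite hVV ?mulr0.
have CYZ h : C h -> Y h \/ Z h.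
  move=> Ch; have Ah := CA _ Ch; have [Gh ah] := (AutE h).1 Ah.
  have [nZ|/forallPn[c]] := boolP [forall c, V c ==> [exists j, V j && (lin h c j != 0)]].
    left; split=> // -[i j] /=; case: ifP => // /andP[Vj Vi].
    have [_ _ _ /(_ h Ah) AhV] := Aut_subgroup I.
    rewrite -[lin h]invmxK -lin_inv //.
    apply: (invmx_stable (V := V)) => // [|i' j' Vj' Vi']; first exact: lin_unit.
    apply/eqP; apply: contraNT Vi' => nz.
    have /implyP/(_ Vj')/existsP[r /andP[Vr hr]] := forallP nZ j'.
    apply: below_trans Vr.
    exact: (lin_normalizes_below char0 var_notin_I Ah (below_refl I j') nz hr).
  rewrite negb_imply => /andP[Vb /existsPn none]; right; exists c.
    by rewrite mem_filter Vb mem_enum.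
  split=> // j; case: ifP => // Vj; apply/eqP.
  by have := none j; rewrite Vj negbK.
have [/(_ g Cg)/YP//|CZ] := cC Y Z cY cZ CYZ YZ.
have Y1 : Y \1%VF.
  split=> [|[i j] /=]; first exact: GL_1.
  case: ifP => // /andP[Vj Vi]; rewrite lin_1 // mxE.
  by case: eqVneq Vi => // ->; rewrite Vj.
by case: (YZ _ C1 Y1 (CZ _ C1)).
Qed.

Lemma Aut_closed : zariski_closed (Aut I).
Proof.
pose F (e : option (A * A) * 'I_(\dim {:A})) (g : 'End(A)) : k :=
  coord (vbasis {:A}) e.2
    (if e.1 is Some ab then g (ab.1 * ab.2) - g ab.1 * g ab.2 else g 1 - 1).
apply: closed_ext (_ : zariski_closed (fun g => GL A g /\ forall e, F e g = 0)).
  move=> g; rewrite AutE; split=> -[Gg]; last first.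
    by case=> gM g1; split=> // -[[[a b]|] i]; rewrite /F /= ?gM ?g1 subrr linear0.
  move=> Fg; split=> //; split=> [a b|]; apply/eqP; rewrite -subr_eq0; apply/eqP.
    rewrite (coord_vbasis (memvf (_ - _))) big1 // => i _.
    by have := Fg (Some (a, b), i); rewrite /F /= => ->; rewrite scale0r.
  rewrite (coord_vbasis (memvf (_ - _))) big1 // => i _.
  by have := Fg (None, i); rewrite /F /= => ->; rewrite scale0r.
apply: closed_equations => -[e i].
suff: polynomial_map (fun g : 'End(A) =>
    if e is Some ab then g (ab.1 * ab.2) - g ab.1 * g ab.2 else g 1 - 1 : A).
  by move/(_ i).
have ev a : polynomial_map (fun g : 'End(A) => g a).
  by apply: polynomial_map_linear => c g h; rewrite add_lfunE scale_lfunE.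
have evN F' : polynomial_map (F' : 'End(A) -> A) -> polynomial_map (fun g => - F' g).
  move=> pF; apply: polynomial_map_ext (polynomial_map_scale (polynomial_cst _ (-1)) pF).
  by move=> g; rewrite scaleN1r.
case: e => [[a b]|] /=; apply: polynomial_mapD => //; apply: evN.
  exact: polynomial_map_mul.
exact: polynomial_map_cst.
Qed.

(** * The unipotent radical *)

Definition strict X := forall i j, X i j != 0 -> strictly_below I i j.

(** The automorphisms acting trivially on the successive quotients of the
    filtration of the cotangent space given by the preorder. *)
Definition radical g := Aut I g /\ strict (lin g - 1%:M).

Lemma strict_upper X : strict X -> upper X.
Proof. by move=> sX i j /sX/andP[]. Qed.

Lemma upper_strictM M X : upper M -> strict X -> strict (M *m X).
Proof.
move=> uM sX i j /mulmx_neq0[l [/uM il /sX lj]].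
exact: below_strictly_below_trans il lj.
Qed.

Lemma strictD X X' : strict X -> strict X' -> strict (X + X').
Proof.
move=> sX sX' i j; rewrite mxE; apply: contraNT => nij.
have /eqP-> : X i j == 0 by apply: contraNT nij; apply: sX.
by rewrite add0r; apply: contraNT nij; apply: sX'.
Qed.

Lemma strictN X : strict X -> strict (- X).
Proof. by move=> sX i j; rewrite mxE oppr_eq0 => /sX. Qed.

Lemma radical_upper g : radical g -> upper (lin g).
Proof.
move=> [_ /strict_upper ug]; rewrite -(subrK 1%:M (lin g)).
exact/upperD/upper1.
Qed.

Lemma radical_subgroup : subgroup radical.
Proof.
have [AGL A1 AM AV] := Aut_subgroup I; split=> [g [/AGL]//||g h rg rh|g rg].
- by split=> //; rewrite lin_1 // subrr => i j; rewrite mxE eqxx.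
- have [[Ag sg] [Ah sh]] := (rg, rh); split; first exact: AM.
  have [_ ag] := (AutE g).1 Ag; rewrite lin_comp //.
  have -> : lin g *m lin h - 1%:M = lin g *m (lin h - 1%:M) + (lin g - 1%:M).
    by rewrite mulmxBr mulmx1 addrA subrK.
  by apply: strictD => //; apply: upper_strictM => //; apply: radical_upper.
have [Ag sg] := rg; split; first exact: AV.
have -> : lin (g^-1)%VF - 1%:M = - (lin (g^-1)%VF *m (lin g - 1%:M)).
  by rewrite mulmxBr lin_mulVmx // mulmx1 opprB.
apply/strictN/upper_strictM => //; rewrite lin_inv //.
by apply: upper_invmx; [apply: lin_unit | apply: radical_upper].
Qed.

Lemma radical_closed : zariski_closed radical.
Proof.
have cS : zariski_closed (fun g => GL A g /\ forall ij,
    (if strictly_below I ij.1 ij.2 then 0 else lin g ij.1 ij.2 - (ij.1 == ij.2)%:R) = 0).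
  apply: closed_equations => -[i j] /=.
  case: (strictly_below I i j); first exact: polynomial_cst.
  by apply: polynomialD (polynomial_cst _ _); apply: polynomial_lin_entry.
apply: closed_ext (closedI Aut_closed cS) => g; split=> -[Ag].
  case=> Gg sg; split=> // i j; apply: contraNT => nij.
  by have := sg (i, j); rewrite /= (negPf nij) !mxE => ->.
move=> sg; split=> //; split=> [|[i j] /=]; first by case/AutE: Ag.
case: ifP => // /negbT nij; apply/eqP; apply: contraNT nij => nz.
by apply: sg; move: nz; rewrite !mxE.
Qed.

Lemma radical_normal : normal_in (Aut I) radical.
Proof.
have [AGL A1 AM AV] := Aut_subgroup I; split=> [g []//|g h Ag [Ah sh]].
have AgV := AV _ Ag; have [Gg ag] := (AutE g).1 Ag; have [_ ah] := (AutE h).1 Ah.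
split; first exact: (AM _ _ (AM _ _ Ag Ah) AgV).
rewrite !lin_comp //; last exact: alg_hom_comp.
have -> : lin g *m lin h *m lin (g^-1)%VF - 1%:M =
    lin g *m (lin h - 1%:M) *m lin (g^-1)%VF.
  by rewrite mulmxBr mulmx1 mulmxBl lin_mulmxV.
move=> l r /mulmx_neq0[j [/mulmx_neq0[i [li /sh/andP[ij ji]]] jr]].
apply/andP; split.
  by apply: (lin_normalizes_below char0 var_notin_I AgV ij) jr; rewrite invK_GL.
apply: contra ji => rl.
exact: (lin_normalizes_below char0 var_notin_I Ag rl jr li).
Qed.

End NeutralComponent.

Section UnipotentRadical.

Variables (k : closedFieldType) (n : nat) (I : cofinite_monomial_ideal k n).
Hypothesis char0 : [pchar k] =i pred0.
Hypothesis var_notin_I : forall i : 'I_n, 'X_i \notin (I : {pred {mpoly k[n]}}).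
Local Notation A := (quot_alg I).
Local Notation pr := (mod_ideal I).
Local Notation upper := (upper I).
Local Notation strict := (strict I).
Implicit Types (m : 'X_{1..n}) (p q : {mpoly k[n]}) (a b : A) (g h D : 'End(A)).
Implicit Types (M N X : 'M[k]_n).

(** The weights increase along the preorder, and any monomial of degree two is
    heavier than any variable; so an element of the radical maps a monomial to
    the sum of itself and of heavier ones. *)
Definition var_weight (i : 'I_n) : nat := n + #|[pred l | below I i l]|.

Definition weight m : nat := \sum_i m i * var_weight i.

Lemma weightD m m' : weight (m + m')%MM = weight m + weight m'.
Proof. by rewrite -big_split; apply: eq_bigr => i _; rewrite mnmDE mulnDl. Qed.

Lemma weight1 i : weight U_(i)%MM = var_weight i.
Proof.
rewrite /weight (bigD1 i) //= mnm1E eqxx mul1n big1 ?addn0 // => j ji.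
by rewrite mnm1E eq_sym (negPf ji).
Qed.

Lemma var_weight_strict i j : strictly_below I i j -> (var_weight j < var_weight i)%N.
Proof.
move=> /andP[ij ji]; rewrite ltn_add2l; apply/proper_card/properP; split.
  by apply/subsetP => l; apply: below_trans.
by exists i; rewrite inE ?below_refl.
Qed.

Lemma var_weight_ge i : (n < var_weight i)%N.
Proof.
rewrite -[X in (X < _)%N]addn0 ltn_add2l; apply/card_gt0P; exists i.
exact: below_refl.
Qed.

Lemma var_weight_le i : (var_weight i <= n + n)%N.
Proof. by rewrite leq_add2l -[X in (_ <= X)%N]card_ord max_card. Qed.

Definition heavy d p := forall m, m \in msupp p -> (d <= weight m)%N.

Lemma heavyD d p q : heavy d p -> heavy d q -> heavy d (p + q).
Proof. by move=> hp hq m /msuppD_le; rewrite mem_cat => /orP[/hp|/hq]. Qed.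

Lemma heavyZ d c p : heavy d p -> heavy d (c *: p).
Proof. by move=> hp m /msuppZ_le/hp. Qed.

Lemma heavyM d d' p q : heavy d p -> heavy d' q -> heavy (d + d') (p * q).
Proof.
move=> hp hq m /msuppM_le/allpairsP[[m1 m2] /= [/hp h1 /hq h2 ->]].
by rewrite weightD leq_add.
Qed.

Lemma heavyX m : heavy (weight m) 'X_[m].
Proof. by move=> m'; rewrite msuppX inE => /eqP->. Qed.

Lemma heavyS d p : heavy d.+1 p -> heavy d p.
Proof. by move=> hp m /hp/ltnW. Qed.

Lemma radical_heavy_var g j : radical g ->
  exists2 p, heavy (var_weight j).+1 p & g (xbar I j) = pr ('X_j + p).
Proof.
move=> [Ag sg]; have [_ ag] := (AutE g).1 Ag.
exists (repr (g (xbar I j)) - 'X_j); last by rewrite addrC subrK mod_ideal_repr.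
move=> m; rewrite mcoeff_msupp mcoeffB => nz.
have [|d1] := leqP (mdeg m) 1; last first.
  apply: leq_trans (_ : (n.+1 * mdeg m <= _)%N).
    apply: leq_trans (_ : (n.+1 * 2 <= _)%N); last by rewrite leq_mul2l.
    by rewrite muln2 -addnn addSn addnS !ltnS leqW // var_weight_le.
  rewrite mdegE big_distrr; apply: leq_sum => i _; rewrite mulnC leq_mul //.
  exact: var_weight_ge.
rewrite leq_eqVlt ltnS leqn0 mdeg_eq0 => /orP[/mdeg1P[i /eqP mi]|/eqP m0].
  rewrite mi weight1; apply: var_weight_strict; apply: sg; rewrite !mxE.
  by move: nz; rewrite mi mcoeffXU (eq_sym j).
have c0 : (repr (g (xbar I j)))@_0%MM = 0.
  by have := const_coef_alg_hom (xbar I j) ag; rewrite const_coef_xbar.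
by move: nz; rewrite m0 c0 mcoeffX mnm1_eq0 subrr eqxx.
Qed.

Lemma radical_heavy_mon g m : radical g ->
  exists2 p, heavy (weight m).+1 p & g (pr 'X_[m]) = pr ('X_[m] + p).
Proof.
move=> rg; have [/AutE[_ ag] _] := rg; elim/mnm_ind: m => [|m j [p hp gp]].
  exists 0; first by move=> m; rewrite msupp0.
  by rewrite addr0 pr_X0; case: ag.
have [q hq gq] := radical_heavy_var j rg.
exists ('X_[m] * q + p * 'X_j + p * q).
  rewrite weightD weight1; apply: heavyD; first apply: heavyD.
  - by rewrite -addnS; apply: heavyM hq; apply: heavyX.
  - by rewrite -addSn; apply: heavyM hp _; rewrite -weight1; apply: heavyX.
  by apply: heavyS; rewrite -addSn -addnS; apply: heavyM.
by rewrite alg_hom_X // gp gq -rmorphM mpolyXD mulrDl !mulrDr -!addrA.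
Qed.

Lemma radical_unipotent : included (@radical k n I) (unipotent (V := A)).
Proof.
move=> g rg; pose deep d a := exists2 p, heavy d p & a = pr p.
have deepP d a : deep d a -> deep d.+1 ((g - \1)%VF a).
  move=> [p hp ->]; rewrite pr_expand linear_sum big_seq.
  apply: big_ind => [|_ _ [q hq ->] [q' hq' ->]|m mp].
  - by exists 0; rewrite ?rmorph0 // => m; rewrite msupp0.
  - by exists (q + q'); rewrite ?rmorphD //; apply: heavyD.
  have [q hq gq] := radical_heavy_mon m rg.
  exists (p@_m *: q); last first.
    by rewrite !linearZ /= add_lfunE opp_lfunE id_lfunE gq rmorphD addrC addKr.
  by apply: heavyZ => m' /hq; apply: leq_trans; rewrite ltnS; apply: hp.
have [K big] := supp_bound I weight; exists K => a.
have [p hp ->] : deep K (iter K (g - \1)%VF a).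
  elim: K {big} => [|K IHK]; last exact: deepP.
  by have [p ->] := mod_idealP a; exists p.
apply/eqP; rewrite mod_ideal_eq0; apply: idealZX => m /hp; exact: big.
Qed.

Lemma nilpotent_trace0 X K : iter K (mulmx X) 1%:M = 0 -> \tr X = 0.
Proof.
move=> nilX; have [n0|n_gt0] := posnP n.
  by rewrite /mxtrace big1 // => i; have := ltn_ord i; rewrite {2}n0.
have [r charX] := closed_field_poly_normal (char_poly X).
have eigX (c : k) : eigenvalue X c -> c = 0.
  move=> /eigenvalueP[v vX nz]; have vI d : v *m iter d (mulmx X) 1%:M = c ^+ d *: v.
    elim: d => [|d IHd]; first by rewrite mulmx1 scale1r.
    by rewrite iterS mulmxA vX -scalemxAl IHd scalerA exprS.
  have /eqP := vI K; rewrite nilX mulmx0 eq_sym scaler_eq0 (negPf nz) orbF.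
  by rewrite expf_eq0 => /andP[_ /eqP].
rewrite (monicP (char_poly_monic X)) scale1r in charX.
have r0 c : c \in r -> c = 0.
  by move=> cr; apply: eigX; rewrite eigenvalue_root_char charX root_prod_XsubC.
have charXn : char_poly X = 'X^(size r).
  rewrite charX big_seq (eq_bigr (fun=> 'X)) => [|a /r0->]; last by rewrite subr0.
  by rewrite -big_seq big_const_seq count_predT -Monoid.iteropE.
have sz : size r = n by have := size_char_poly X; rewrite charXn size_polyXn => -[].
have := char_poly_trace X n_gt0; rewrite charXn sz coefXn.
by rewrite ltn_eqF ?prednK // => /eqP; rewrite eq_sym oppr_eq0 => /eqP.
Qed.

Lemma lin_coef_iter g K : alg_hom g ->
  \matrix_(i, j) lin_coef i (iter K (g - \1)%VF (xbar I j)) =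
  iter K (mulmx (lin g - 1%:M)) 1%:M.
Proof.
move=> ag; elim: K => [|K IHK].
  by apply/matrixP => i j; rewrite !mxE lin_coef_xbar.
apply/matrixP => i j; rewrite iterS -IHK !mxE /= add_lfunE opp_lfunE id_lfunE.
rewrite linearB /= lin_coef_alg_hom //.
under [RHS]eq_bigr do rewrite !mxE mulrBl.
rewrite sumrB; congr (_ - _); first by apply: eq_bigr => l _; rewrite mxE.
rewrite (bigD1 i) //= eqxx mul1r big1 ?addr0 // => l.
by rewrite eq_sym => /negPf->; rewrite mul0r.
Qed.

Lemma unipotent_trace g : alg_hom g -> unipotent g -> \tr (lin g - 1%:M) = 0.
Proof.
move=> ag [K gK]; apply: (@nilpotent_trace0 _ K); rewrite -lin_coef_iter //.
by apply/matrixP => i j; rewrite !mxE gK linear0.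
Qed.

Lemma nilpotent_diag0 X K : upper X ->
    (forall i j, equivalent I i j -> i != j -> X i j = 0) ->
  iter K (mulmx X) 1%:M = 0 -> forall i, X i i = 0.
Proof.
move=> uX X0 nilX i; suff [_ XK] : (forall i j, iter K (mulmx X) 1%:M i j != 0 ->
    (i == j) || strictly_below I i j) /\ iter K (mulmx X) 1%:M i i = X i i ^+ K.
  by move/eqP: XK; rewrite nilX mxE eq_sym expf_eq0 => /andP[_ /eqP].
have Xs i' j' : X i' j' != 0 -> (i' == j') || strictly_below I i' j'.
  move=> nz; have := uX _ _ nz; rewrite below_split => /orP[e|->]; last by rewrite orbT.
  by rewrite orbC; apply: contraNT nz; rewrite negb_or => /andP[_ /X0->].
elim: K {nilX} => [|K [IHs IHd]] /=.
  split=> [i' j'|]; rewrite mxE; last by rewrite eqxx.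
  by case: (i' == j'); rewrite ?eqxx.
split=> [i' j' /mulmx_neq0[l [/Xs il /IHs lj]]|].
  case/predU1P: il => [-> //|il]; case/predU1P: lj => [<-|/andP[lj _]].
    by rewrite il orbT.
  by rewrite (strictly_below_below_trans il lj) orbT.
rewrite mxE (bigD1 i) //= IHd exprS big1 ?addr0 // => l li.
apply/eqP; rewrite mulf_eq0; apply: contraNT li; rewrite negb_or => /andP[/Xs il /IHs].
rewrite eq_sym in il *; case/predU1P: il => [->//|/andP[il nli]] /predU1P[->//|/andP[bli _]].
by rewrite bli in nli.
Qed.

(** For x in a normal unipotent subgroup with linear part 1 + X, and h = 1 + E
    with E an elementary matrix of the preorder, the product of x with its
    conjugate by h is unipotent.  Comparing traces gives tr (X h X h^-1) = 0,
    that is X_ji^2 = 0. *)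
Lemma normal_unipotent_radical R : subgroup R -> normal_in (Aut I) R ->
    included R (unipotent (V := A)) -> included R (neutral_component (Aut I)) ->
  included R (@radical k n I).
Proof.
move=> [_ _ RM _] [RA RN] RU R0 g Rg.
have [Ag uM] := neutral_upper char0 var_notin_I (R0 g Rg).
have [_ ag] := (AutE g).1 Ag; have [_ _ AM AV] := Aut_subgroup I.
split=> //; have [X defX] : exists X, lin g - 1%:M = X by exists (lin g - 1%:M).
have uX : upper X.
  by rewrite -defX; apply: upperD uM _; rewrite -scaleN1r; apply: upperZ; apply: upper1.
have trX : \tr X = 0 by rewrite -defX; apply: unipotent_trace ag (RU g Rg).
have trXX N : N \in unitmx -> upper N -> \tr (X *m (N *m X *m invmx N)) = 0.
  move=> unitN uN; have Ah := linear_subst_Aut unitN uN.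
  have Rgh := RN _ _ Ah Rg; have [_ ah] := (AutE _).1 Ah.
  have [_ agh] := (AutE _).1 (RA _ (RM _ _ Rg Rgh)).
  have := unipotent_trace agh (RU _ (RM _ _ Rg Rgh)).
  rewrite !lin_comp //; last exact: alg_hom_comp.
  rewrite lin_inv // lin_linear_subst_upper // -(subrK 1%:M (lin g)) defX.
  rewrite mulmxDr mulmx1 [(N *m X + N) *m _]mulmxDl mulmxV //.
  have trY : \tr (N *m X *m invmx N) = 0 by rewrite mxtrace_mulC mulmxA mulVmx // mul1mx.
  rewrite mulmxDl mul1mx mulmxDr mulmx1 addrA addrK.
  rewrite [\tr (_ + _ + _)]mxtraceD [\tr (_ + X)]mxtraceD trX trY !addr0.
  exact.
have Xji i j : below I i j -> i != j -> X j i = 0.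
  move=> bij nij; pose E : 'M[k]_n := delta_mx i j.
  have EE : E *m E = 0.
    by rewrite /E mul_delta_mx_cond eq_sym (negPf nij).
  have EV : (1%:M + E) *m (1%:M - E) = 1%:M.
    by rewrite mulmxBr mulmx1 mulmxDl mul1mx EE addr0 addrK.
  have [unitE _] := mulmx1_unit EV.
  have uE : upper (1%:M + E).
    apply: upperD; first exact: upper1.
    by move=> i' j'; rewrite mxE; case: andP => [[/eqP-> /eqP->]|]; rewrite ?eqxx.
  have invE : invmx (1%:M + E) = 1%:M - E.
    have := congr1 (mulmx (invmx (1%:M + E))) EV.
    by rewrite mulmxA mulVmx // mul1mx mulmx1 => ->.
  have tXX : \tr (X *m X) = 0.
    by have := trXX 1%:M (unitmx1 _ _) (@upper1 _ _ I); rewrite mul1mx invmx1 mulmx1.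
  have := trXX _ unitE uE; rewrite invE.
  have -> : X *m ((1%:M + E) *m X *m (1%:M - E)) =
      X *m X + X *m (E *m X) - (X *m (X *m E) + X *m (E *m X *m E)).
    by rewrite mulmxDl mul1mx mulmxBr mulmx1 mulmxDl mulmxBr !mulmxDr.
  rewrite raddfB /= !mxtraceD tXX add0r [\tr (X *m (E *m X))]mxtrace_mulC -!mulmxA.
  rewrite [\tr (E *m _)]mxtrace_mulC -mulmxA opprD addrA subrr add0r => /eqP.
  rewrite oppr_eq0.
  have -> : \tr (X *m (E *m (X *m E))) = X j i * X j i.
    have -> : E *m (X *m E) = X j i *: E.
      rewrite mulmxA; apply/matrixP => i' j'; rewrite !mxE (bigD1 i) //= big1 => [|l /negPf li].
        rewrite !mxE eqxx addr0 (bigD1 j) //= big1 => [|l /negPf lj].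
          by rewrite !mxE eqxx andbT addr0; case: eqP; case: eqP;
            rewrite /= ?(mul1r, mul0r, mulr1, mulr0).
        by rewrite !mxE lj andbF mul0r.
      by rewrite !mxE li mulr0.
    rewrite -scalemxAr mxtraceZ; congr (_ * _).
    rewrite /mxtrace (bigD1 j) //= big1 => [|l /negPf lj].
      rewrite mxE (bigD1 i) //= big1 => [|l /negPf li]; first by rewrite !mxE !eqxx mulr1 !addr0.
      by rewrite !mxE li mulr0.
    by rewrite mxE big1 // => l' _; rewrite !mxE lj andbF mulr0.
  by rewrite mulf_eq0 orbb => /eqP.
have X0 i j : equivalent I i j -> i != j -> X i j = 0.
  by move=> /andP[_ ji] ij; apply: Xji ji _; rewrite eq_sym.
have [K gK] := RU g Rg.
have Xii : forall i, X i i = 0.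
  apply: (@nilpotent_diag0 _ K uX X0); rewrite -defX -lin_coef_iter //.
  by apply/matrixP => i j; rewrite !mxE gK linear0.
rewrite defX => i j nz; have := uX i j nz; rewrite below_split => /orP[e|//].
case: (eqVneq i j) nz => [->|ij]; first by rewrite Xii eqxx.
by rewrite X0 // eqxx.
Qed.

Lemma unipotent_radicalE R : is_unipotent_radical (Aut I) R ->
  forall g, R g <-> radical g.
Proof.
move=> [[[gR cR] conR nR uR] maxR] g; split.
  apply: normal_unipotent_radical => //.
  have [RA _] := nR; apply: neutral_component_included => //.
  by case: gR.
apply: maxR; split.
- by split; [apply: radical_subgroup | apply: radical_closed].
- apply: (connected_unipotent_subgroup char0); first exact: radical_subgroup.
  exact: radical_unipotent.
- exact: radical_normal.
exact: radical_unipotent.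
Qed.

End UnipotentRadical.

(** * Generation of block matrices *)

Section BlockElimination.

Variables (F : fieldType) (n : nat) (r : rel 'I_n) (Q : 'M[F]_n -> Prop).
Hypothesis r_refl : forall i, r i i.
Hypothesis r_sym : forall i j, r i j = r j i.
Hypothesis r_trans : forall j i l, r i j -> r j l -> r i l.
Hypothesis QM : forall M N, Q M -> Q N -> Q (M *m N).
Hypothesis Qdiag : forall t : 'rV_n, (forall i, t 0 i != 0) -> Q (diag_mx t).
Hypothesis Qelem : forall i j c, r i j -> i != j -> Q (1%:M + c *: delta_mx i j).

Lemma elimination1 : Q 1%:M.
Proof.
have -> : 1%:M = diag_mx (const_mx 1) :> 'M[F]_n by rewrite diag_const_mx.
by apply: Qdiag => i; rewrite mxE oner_neq0.
Qed.

(** The products of two of the matrices X_ij E_ij vanish, hence 1 + X is the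
    product of the elementary matrices 1 + X_ij E_ij. *)
Lemma elimination_square0 (P : pred 'I_n) (X : 'M[F]_n) :
  (forall i j, X i j != 0 -> [&& r i j, P i & ~~ P j]) -> Q (1%:M + X).
Proof.
move=> XP; rewrite [X]matrix_sum_delta pair_big /=.
move: (index_enum _) => s; elim: s => [|[i j] s IHs] /=.
  by rewrite big_nil addr0; exact: elimination1.
rewrite big_cons /=; set S := \sum_(e <- s) _ in IHs *.
have [->|nz] := eqVneq (X i j) 0; first by rewrite scale0r add0r.
have /and3P[rij Pi Pj] := XP i j nz.
have -> : 1%:M + (X i j *: delta_mx i j + S) = (1%:M + S) *m (1%:M + X i j *: delta_mx i j).
  rewrite mulmxDr mulmx1 mulmxDl mul1mx -scalemxAr.
  suff -> : S *m delta_mx i j = 0 by rewrite scaler0 addr0 addrA addrAC.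
  rewrite /S mulmx_suml; apply: big1 => -[i' j'] _ /=; rewrite -scalemxAl mul_delta_mx_cond.
  have [->|nz'] := eqVneq (X i' j') 0; first by rewrite scale0r.
  have /and3P[_ _ Pj'] := XP i' j' nz'.
  by case: eqVneq Pj' => [->|]; rewrite ?Pi // mulr0n scaler0.
apply: QM => //; apply: Qelem => //.
by apply: contraTneq Pi => ->.
Qed.

(** Gaussian elimination inside of the classes of r; the induction is on the
    size d of the upper left corner outside of which B is the identity. *)
Lemma elimination B : B \in unitmx -> (forall i j, B i j != 0 -> r i j) -> Q B.
Proof.
pose corner d (M : 'M[F]_n) :=
  forall i j : 'I_n, (d <= i)%N || (d <= j)%N -> M i j = (i == j)%:R.
suff elim_corner d (M : 'M[F]_n) : corner d M -> M \in unitmx ->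
    (forall i j, M i j != 0 -> r i j) -> Q M.
  by apply: (elim_corner n) => i j; rewrite !(leqNgt n) !ltn_ord.
elim: d M => [|d IHd] M cM uM rM.
  suff -> : M = 1%:M by exact: elimination1.
  by apply/matrixP => i j; rewrite cM ?leq0n // mxE.
have [nd|dn] := leqP n d.
  apply: IHd => // i j; have lt (l : 'I_n) : (d <= l)%N = false.
    by apply/negbTE; rewrite -ltnNge (leq_trans (ltn_ord l)).
  by rewrite !lt.
pose c := Ordinal dn.
have pivot N : corner d.+1 N -> N \in unitmx ->
    (forall i j, N i j != 0 -> r i j) -> N c c != 0 -> Q N.
  move=> cN uN rN Ncc; pose V := \matrix_(i, j) if (i != c) && (j == c) then N i c / N c c else 0.
  pose W := \matrix_(i, j) if (i == c) && (j != c) then N c j / N c c else 0.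
  pose t := \row_i (if i == c then N c c else 1).
  pose N' := \matrix_(i, j) if (i == c) || (j == c) then (i == j)%:R
    else N i j - N i c * N c j / N c c.
  (* N' is the Schur complement of the pivot N c c. *)
  have defN : N = (1%:M + V) *m (diag_mx t *m N') *m (1%:M + W).
    rewrite mulmxDr mulmx1; apply/matrixP => i j.
    have SE i' j' : (diag_mx t *m N') i' j' = t 0 i' * N' i' j' by rewrite mul_diag_mx mxE.
    have VS i' j' : ((1%:M + V) *m (diag_mx t *m N')) i' j' =
        t 0 i' * N' i' j' + V i' c * (N c c * N' c j').
      rewrite mulmxDl mul1mx mxE SE [(V *m _) i' j']mxE (bigD1 c) //= SE.
      rewrite [t 0 c]mxE eqxx big1 ?addr0 // => l lc.
      by rewrite [V _ _]mxE (negPf lc) andbF mul0r.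
    rewrite mxE VS [X in _ + X]mxE (bigD1 c) //= big1 ?addr0 => [|l lc]; last first.
      by rewrite [W _ _]mxE (negPf lc) mulr0.
    rewrite VS !mxE !eqxx /= !orbT.
    have [->|ic] := eqVneq i c; have [->|jc] := eqVneq j c; rewrite ?eqxx /=.
    - by rewrite !(mul0r, mulr0, addr0, mulr1).
    - rewrite !(mul0r, mulr0, addr0, mulr1, mul1r, add0r).
      by rewrite mulrCA mulfV // mulr1.
    - rewrite !(mul0r, mulr0, addr0, mulr1, mul1r, add0r).
      by rewrite (negPf ic) add0r mulfVK.
    rewrite !(mul0r, mulr0, addr0, mulr1, mul1r, add0r).
    by rewrite mulfVK // mulrA subrK.
  have uN' : N' \in unitmx.
    by move: uN; rewrite defN !unitmx_mul => /andP[/andP[_ /andP[]]].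
  have nz_div x y : x / y != 0 :> F -> x != 0.
    by apply: contraNneq => ->; rewrite mul0r.
  rewrite defN; apply: QM; first apply: QM; last first.
  - apply: (@elimination_square0 (pred1 c)) => i j; rewrite mxE /=.
    by case: ifP => [/andP[/eqP-> jc] /nz_div/rN->|]; rewrite /= ?eqxx ?jc.
  - apply: QM; first by apply: Qdiag => i; rewrite mxE; case: ifP; rewrite ?oner_neq0.
    apply: IHd uN' _ => i j.
      rewrite mxE; case: ifPn => //; rewrite negb_or => /andP[ic jc].
      have lt (l : 'I_n) : l != c -> (d <= l)%N = (d < l)%N.
        by move=> lc; rewrite leq_eqVlt eq_sym -[d]/(val c) val_eqE (negPf lc).
      rewrite !lt // => dij; rewrite cN //; case/orP: dij => dl.
        by rewrite (cN i) ?dl // (negPf ic) mul0r mul0r subr0.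
      by rewrite (cN c j) ?dl ?orbT // (eq_sym c) (negPf jc) mulr0 mul0r subr0.
    rewrite mxE; case: ifP => [_|_].
      by case: (eqVneq i j) => [->|]; rewrite ?r_refl ?eqxx.
    have [z|/rN//] := eqVneq (N i j) 0; rewrite z sub0r oppr_eq0 => /nz_div.
    by rewrite mulf_eq0 negb_or => /andP[/rN ic /rN cj]; apply: r_trans ic cj.
  apply: (@elimination_square0 (predC1 c)) => i j; rewrite mxE /=.
  by case: ifP => [/andP[ic /eqP->] /nz_div/rN->|]; rewrite /= ?eqxx ?ic.
have [Mcc|] := eqVneq (M c c) 0; last exact: pivot.
have [i Mic] : exists i, M i c != 0.
  have [i Mic|M0] := pickP (fun i => M i c != 0); first by exists i.
  have /matrixP/(_ c c) : invmx M *m M = 1%:M by rewrite mulVmx.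
  rewrite !mxE eqxx big1 => [/eqP|i _]; first by rewrite eq_sym oner_eq0.
  by have /negbFE/eqP-> := M0 i; rewrite mulr0.
have ic : i != c by apply: contraTneq Mic => ->; rewrite Mcc eqxx.
have di : (d < i)%N = false.
  by apply: contraNF Mic => di; rewrite cM ?di // (negPf ic).
have rci : r c i by rewrite r_sym; apply: rM.
pose E x : 'M[F]_n := 1%:M + x *: delta_mx c i.
have EN : E (-1) *m E 1 = 1%:M.
  rewrite mulmxDl mul1mx mulmxDr mulmx1 -scalemxAl -scalemxAr mul_delta_mx_cond.
  by rewrite (negPf ic) mulr0n !scaler0 addr0 -addrA -scalerDl subrr scale0r addr0.
have E1M j l : (E 1 *m M) j l = M j l + (j == c)%:R * M i l.
  rewrite mulmxDl mul1mx mxE; congr (_ + _); rewrite scale1r mxE (bigD1 i) //= big1.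
    by rewrite mxE eqxx andbT addr0.
  by move=> l' /negPf l'i; rewrite mxE l'i andbF mul0r.
(* Adding the row i to the row c makes the pivot nonzero. *)
have -> : M = E (-1) *m (E 1 *m M) by rewrite mulmxA EN mul1mx.
apply: QM; first by apply: Qelem; rewrite // eq_sym.
have [_ uE] := mulmx1_unit EN.
apply: pivot.
- move=> j l; rewrite E1M; have [->|jc] := eqVneq j c; last first.
    by move=> djl; rewrite mul0r addr0 cM // (negPf jc).
  rewrite ltnn /= => djl.
  rewrite mul1r !cM ?djl ?orbT //.
  by case: (eqVneq i l) djl => [<-|]; rewrite ?di ?addr0.
- by rewrite unitmx_mul uE.
- move=> j l; rewrite E1M; have [->|jc] := eqVneq j c; last by rewrite mul0r addr0 => /rM.
  have [z|/rM//] := eqVneq (M c l) 0; rewrite z add0r mul1r => /rM il.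
  exact: r_trans rci il.
by rewrite E1M eqxx mul1r Mcc add0r.
Qed.

End BlockElimination.

(** * The Levi subgroup *)

Section LeviSubgroup.

Variables (k : fieldType) (n : nat) (I : cofinite_monomial_ideal k n).
Hypothesis char0 : [pchar k] =i pred0.
Hypothesis var_notin_I : forall i : 'I_n, 'X_i \notin (I : {pred {mpoly k[n]}}).
Local Notation A := (quot_alg I).
Local Notation pr := (mod_ideal I).
Local Notation upper := (upper I).
Local Notation strict := (strict I).
Local Notation equivalent := (equivalent I).
Implicit Types (m : 'X_{1..n}) (p q : {mpoly k[n]}) (a b : A) (g h D : 'End(A)).
Implicit Types (M N X B : 'M[k]_n).

Definition block M := forall i j, M i j != 0 -> equivalent i j.

Definition block_part M := restrict equivalent M.

Lemma block_upper M : block M -> upper M.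
Proof. by move=> bM i j /bM/andP[]. Qed.

Lemma block_part_block M : block (block_part M).
Proof. by move=> i j; rewrite mxE; case: ifP => // _ /eqP. Qed.

Lemma block_part_id M : block M -> block_part M = M.
Proof. exact: restrict_id. Qed.

Lemma block1 : block 1%:M.
Proof.
by move=> i j; rewrite mxE; case: (eqVneq i j) => [->|]; rewrite ?equivalent_refl ?eqxx.
Qed.

Lemma blockM M N : block M -> block N -> block (M *m N).
Proof.
move=> bM bN i j /mulmx_neq0[l [/bM il /bN lj]].
exact: equivalent_trans il lj.
Qed.

Lemma block_invmx M : M \in unitmx -> block M -> block (invmx M).
Proof.
move=> uM bM i j; apply: contraNT => nij; apply/eqP.
apply: (invmx_stable (V := fun l => equivalent l j)) => //; last exact: equivalent_refl.
move=> i' j' Vj' Vi'; apply/eqP; apply: contraNT Vi' => /bM ij.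
exact: equivalent_trans ij Vj'.
Qed.

Lemma block_partM M N : upper M -> upper N ->
  block_part (M *m N) = block_part M *m block_part N.
Proof.
move=> uM uN; apply/matrixP => i j; rewrite !mxE; case: ifPn => [eij|nij].
  apply: eq_bigr => l _; rewrite !mxE.
  have [->|/uM il] := eqVneq (M i l) 0; first by rewrite if_same !mul0r.
  have [->|/uN lj] := eqVneq (N l j) 0; first by rewrite if_same !mulr0.
  have /andP[_ ji] := eij.
  by rewrite /equivalent il lj (below_trans lj ji) (below_trans ji il).
apply/esym/big1 => l _; rewrite !mxE.
case: ifP => il; last by rewrite mul0r.
case: ifP => lj; last by rewrite mulr0.
by rewrite (equivalent_trans il lj) in nij.
Qed.

Lemma block_part_unit M : M \in unitmx -> upper M -> block_part M \in unitmx.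
Proof.
move=> unitM uM; have := block_partM uM (upper_invmx unitM uM).
by rewrite mulmxV // (block_part_id block1) => /esym/mulmx1_unit[].
Qed.

Lemma block_part_strict X : strict X -> block_part X = 0.
Proof.
move=> sX; apply/matrixP => i j; rewrite !mxE; case: ifP => // eij.
apply/eqP; apply: contraTT eij => /sX/strictly_below_not_equivalent->.
by [].
Qed.

Lemma block_partD M N : block_part (M + N) = block_part M + block_part N.
Proof. by have := restrict_linear equivalent 1 M N; rewrite !scale1r. Qed.

Lemma block_part_radical g : radical g -> block_part (lin g) = 1%:M.
Proof.
move=> [_ sg]; rewrite -(subrK 1%:M (lin g)) block_partD block_part_strict //.
by rewrite add0r block_part_id //; apply: block1.
Qed.

Definition levi g := exists2 B, B \in unitmx /\ block B & g = linear_subst I B.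

Definition levi_part g := linear_subst I (block_part (lin g)).

Lemma levi_lin g : levi g -> [/\ lin g \in unitmx, block (lin g) & g = linear_subst I (lin g)].
Proof.
by move=> [B [uB bB] ->]; rewrite lin_linear_subst_upper //; apply: block_upper.
Qed.

Lemma levi_Aut g : levi g -> Aut I g.
Proof. by move=> [B [uB bB] ->]; apply: linear_subst_Aut => //; apply: block_upper. Qed.

Lemma levi_part_id g : levi g -> levi_part g = g.
Proof. by move/levi_lin => [_ bg {2}->]; rewrite /levi_part block_part_id. Qed.

Lemma levi_part_levi g : Aut I g -> upper (lin g) -> levi (levi_part g).
Proof.
move=> Ag ug; exists (block_part (lin g)) => //; split; last exact: block_part_block.
by apply: block_part_unit => //; apply: lin_unit.
Qed.

Lemma levi_subgroup : subgroup levi.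
Proof.
split=> [g /levi_Aut/AutE[]//||g h [B [uB bB] ->] [B' [uB' bB'] ->]|g [B [uB bB] ->]].
- exists 1%:M; last by rewrite linear_subst1.
  by split; [apply: unitmx1 | apply: block1].
- exists (B *m B'); last by rewrite linear_subst_comp //; apply: block_upper.
  by rewrite unitmx_mul uB; split=> //; apply: blockM.
exists (invmx B); last by rewrite linear_subst_inv //; apply: block_upper.
by rewrite unitmx_inv; split=> //; apply: block_invmx.
Qed.

Lemma polynomial_levi_part : polynomial_map levi_part.
Proof.
apply: (polynomial_map_comp (F := linear_subst I) (F' := fun g => block_part (lin g))).
  apply: polynomial_map_linear => c g h.
  rewrite lin_linear //; apply/matrixP => i j; rewrite !mxE.
  by case: ifP; rewrite ?mulr0 ?addr0.
exact: polynomial_linear_subst.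
Qed.

Lemma levi_closed : zariski_closed levi.
Proof.
pose F i g : k := coord (vbasis {:'End(A)}) i (g - levi_part g).
apply: closed_ext (_ : zariski_closed (fun g => GL A g /\ forall i, F i g = 0)).
  move=> g; split=> [[Gg g0]|lg]; last first.
    split=> [|i]; first by have /AutE[] := levi_Aut lg.
    by rewrite /F levi_part_id // subrr linear0.
  have gE : g = levi_part g.
    apply/eqP; rewrite -subr_eq0; apply/eqP.
    rewrite (coord_vbasis (memvf (_ - _))) big1 // => i _.
    by rewrite -/(F i g) g0 scale0r.
  have Ag : Aut I g.
    by apply/AutE; split=> //; rewrite gE; apply: alg_hom_linear_subst.
  rewrite gE; apply: levi_part_levi => //; rewrite gE lin_linear_subst //.
  by apply: upper_restrict.
apply: closed_equations => i.
suff : polynomial_map (fun g => g - levi_part g) by move/(_ i).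
apply: polynomial_mapD; first exact: polynomial_map_linear.
apply: polynomial_map_ext (polynomial_map_scale (polynomial_cst _ (-1)) polynomial_levi_part).
by move=> g; rewrite scaleN1r.
Qed.

(** * Roots and root subgroups *)

Lemma is_exp_unique t D g h : is_exp t D g -> is_exp t D h -> g = h.
Proof.
move=> gE hE; apply/lfunP => a; have [N DN ->] := gE a; have [N' DN' ->] := hE a.
have D0 s r : iter r D a = 0 -> (r <= s)%N -> iter s D a = 0.
  by move=> Dr /subnK<-; rewrite iterD Dr; elim: (s - r)%N => //= s' ->; rewrite linear0.
have wide r d : iter r D a = 0 -> (r <= d)%N ->
    \sum_(j < r) (t ^+ j / j`!%:R) *: iter j D a =
    \sum_(j < d) (t ^+ j / j`!%:R) *: iter j D a.
  move=> Dr rd; rewrite (big_ord_widen _ (fun j => (t ^+ j / j`!%:R) *: iter j D a) rd).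
  rewrite big_mkcond; apply: eq_bigr => j _; case: ltnP => // /(D0 _ _ Dr)->.
  by rewrite scaler0.
by rewrite (wide N (N + N')%N) ?leq_addr // (wide N' (N + N')%N) ?leq_addl.
Qed.

Lemma block_elementary i j c : equivalent i j -> block (1%:M + c *: delta_mx i j).
Proof.
move=> ij i' j'; rewrite !mxE; have [->|_] := eqVneq i' j'; first by rewrite equivalent_refl.
rewrite add0r; have [->|_] := eqVneq i' i; last by rewrite mulr0 eqxx.
by have [->|_] := eqVneq j' j; rewrite // mulr0 eqxx.
Qed.

Lemma elementary_unit i j (c : k) : i != j -> 1%:M + c *: delta_mx i j \in @unitmx k n.
Proof.
move=> ij; have : (1%:M + c *: delta_mx i j) *m (1%:M - c *: delta_mx i j) = 1%:M :> 'M[k]_n.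
  rewrite mulmxBr mulmx1 mulmxDl mul1mx -scalemxAl -scalemxAr mul_delta_mx_cond.
  by rewrite eq_sym (negPf ij) mulr0n !scaler0 addr0 addrK.
by case/mulmx1_unit.
Qed.

(** On monomials the exponential series is multiplied by x_j + t x_i, respectively
    by x_l, when a factor x_j, respectively x_l with l <> j, is added. *)
Lemma exp_elementary i j t D : i != j -> below I i j ->
    (forall p, D (pr p) = pr ('X_i * p^`M(j))) -> derivation D ->
  is_exp t D (linear_subst I (1%:M + t *: delta_mx i j)).
Proof.
move=> ij bij DE DM; pose phi := linear_subst I (1%:M + t *: delta_mx i j).
pose e d (a : A) : A := \sum_(s < d) (t ^+ s / s`!%:R) *: iter s D a.
have uE : upper (1%:M + t *: delta_mx i j).
  apply: upperD; first exact: upper1.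
  apply: upperZ => i' j'; rewrite mxE.
  by case: andP => [[/eqP-> /eqP->]|]; rewrite ?eqxx.
have phix l : phi (xbar I l) = xbar I l + ((l == j)%:R * t) *: xbar I i.
  rewrite linear_subst_xbar restrict_id //; under eq_bigr do rewrite !mxE scalerDl.
  rewrite big_split /= (bigD1 l) //= eqxx scale1r big1 ?addr0 => [|l' /negPf->]; last first.
    by rewrite scale0r.
  congr (_ + _); rewrite (bigD1 i) //= eqxx /= mulrC big1 ?addr0 // => l' /negPf->.
  by rewrite mulr0 scale0r.
have Dx l : D (xbar I l) = (l == j)%:R *: xbar I i.
  rewrite DE mderivX mnm1E -scalerAr linearZ /=.
  have [->|_] := eqVneq l j; last by rewrite !scale0r.
  by rewrite -[X in (X - _)%MM]add0m addmK mpolyX0 mulr1.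
have DDx l : D (D (xbar I l)) = 0 by rewrite Dx linearZ /= Dx (negPf ij) scale0r scaler0.
have iterM a l s : iter s D (a * xbar I l) =
    iter s D a * xbar I l + s%:R *: (iter s.-1 D a * D (xbar I l)).
  elim: s => [|s IHs]; first by rewrite scale0r addr0.
  rewrite iterS IHs linearD linearZ /= !DM DDx mulr0 addr0 -addrA; congr (_ + _).
  case: s {IHs} => [|s]; first by rewrite scale0r addr0 scale1r.
  by rewrite -[X in X + _]scale1r -scalerDl nat1r.
pose P a := exists K, forall d, (K <= d)%N -> iter d D a = 0 /\ phi a = e d a.
suff PA a : P a.
  by move=> a; have [K /(_ K (leqnn K))[aN aE]] := PA a; exists K.
have PD b b' : P b -> P b' -> P (b + b').
  move=> [K PN] [K' PN']; exists (K + K')%N => d dN.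
  have [b0 bE] := PN d (leq_trans (leq_addr _ _) dN).
  have [b'0 b'E] := PN' d (leq_trans (leq_addl _ _) dN).
  have iterD s : iter s D (b + b') = iter s D b + iter s D b'.
    by elim: s => //= s ->; rewrite linearD.
  rewrite iterD b0 b'0 addr0 linearD /= bE b'E /e -big_split; split=> //.
  by apply: eq_bigr => s _; rewrite iterD scalerDr.
have PZ c b : P b -> P (c *: b).
  move=> [K PN]; exists K => d /PN[b0 bE].
  have iterZ s : iter s D (c *: b) = c *: iter s D b.
    by elim: s => //= s ->; rewrite linearZ.
  rewrite iterZ b0 scaler0 linearZ /= bE /e scaler_sumr; split=> //.
  by apply: eq_bigr => s _; rewrite iterZ !scalerA mulrC.
have [p ->] := mod_idealP a; rewrite pr_expand.
apply: (big_ind P) => [||m _]; [|exact: PD|apply: PZ].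
  have iter0 s : iter s D 0 = 0 by elim: s => //= s ->; rewrite linear0.
  exists 0%N => d _; rewrite iter0 linear0 /e big1 // => s _.
  by rewrite iter0 scaler0.
elim/mnm_ind: m => [|m l [K PN]].
  have D1 s : iter s.+1 D 1 = 0.
    by elim: s => [|s IHs]; rewrite iterS ?IHs ?linear0 //= derivation_1.
  have [_ phi1] := alg_hom_linear_subst I (1%:M + t *: delta_mx i j).
  exists 1%N => -[|d] // _; rewrite pr_X0 D1 /phi phi1 /e; split=> //.
  rewrite big_ord_recl /= big1 => [|s _]; last by rewrite -iterS D1 scaler0.
  by rewrite fact0 divr1 scale1r addr0.
exists K.+1 => -[|d] // dN; rewrite mpolyXD rmorphM -/(xbar I l).
have [aN aE] := PN d dN; have [aSN aSE] := PN d.+1 (leqW dN).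
set a' := pr 'X_[m] in aN aE aSN aSE *; rewrite iterM aN aSN !mul0r scaler0 addr0.
split=> //; have [phiM _] := alg_hom_linear_subst I (1%:M + t *: delta_mx i j).
rewrite /phi phiM -/phi phix mulrDr {1}aSE aE /e.
under [RHS]eq_bigr do rewrite iterM scalerDr.
rewrite big_split /= mulr_suml; congr (_ + _).
  by apply: eq_bigr => s _; rewrite scalerAl.
rewrite big_ord_recl /= scale0r scaler0 add0r mulr_suml; apply: eq_bigr => s _.
rewrite /= add0n Dx -!scalerAl -!scalerAr !scalerA factS natrM; congr (_ *: _).
have f0 d' : d'`!%:R != 0 :> k by case: d'`! (fact_gt0 d') => // d'' _; apply: natr_neq0.
rewrite /bump /= add1n exprS invfM (mulrC _^-1) !mulrA mulfVK ?natr_neq0 //.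
by rewrite [LHS]mulrC !mulrA.
Qed.

Lemma homog_derivationE i j p : i != j ->
  homog_derivation (unit_vector i - unit_vector j) (dual_vector k j) p =
  'X_i * p^`M(j).
Proof.
move=> ij; rewrite /homog_derivation [p in RHS]mpolyE (linear_sum (mderiv j)) mulr_sumr.
apply: eq_bigr => m _; rewrite (linearZ_LR (mderiv j)) /= mderivX scalerA -scalerAr.
rewrite /dual_vector mxE; have [mj|mj] := posnP (m j); first by rewrite mj !mulr0 !scale0r.
congr (_ *: _); rewrite /laurent_monomial -mpolyXD.
have coordE l : (exponent m + (unit_vector i - unit_vector j)) 0 l =
    ((U_(i) + (m - U_(j)))%MM l)%:Z.
  rewrite !mxE eqxx /= mnmDE mnmBE !mnm1E !(eq_sym l) !natz.
  have [jl|jl] := eqVneq j l; last by rewrite subr0 subn0 addrC PoszD.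
  have ml : (0 < m l)%N by rewrite -jl.
  by rewrite PoszD -subzn // addrCA.
case: ifP => [_|/negP[]].
  by congr 'X_[_]; apply/mnmP => l; rewrite mnmE coordE absz_nat.
by apply/forallP => l; rewrite coordE.
Qed.

(** A nonzero homogeneous derivation of degree e_i - e_j kills all variables but
    x_j, which it maps to a multiple of x_i. *)
Lemma root_below i j : i != j -> Defs.root I (unit_vector i - unit_vector j) -> below I i j.
Proof.
move=> ij [_ [D [DM homD D0]]].
have [l Dl] : exists l, D (xbar I l) != 0.
  have [l Dl|Dx0] := pickP (fun l => D (xbar I l) != 0); first by exists l.
  case/eqP: D0; apply: lfun_eq_mon => m; rewrite derivation_chain // zero_lfunE big1 // => l _.
  by have /negbFE/eqP-> := Dx0 l; rewrite mulr0.
have [|Dl0|[m [c [mE DlE]]]] := homD (exponent U_(l)%MM) (xbar I l).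
- by right; exists U_(l)%MM, 1; rewrite scale1r.
- by rewrite Dl0 eqxx in Dl.
have mlE r : (m r)%:Z = (l == r)%:Z + ((i == r)%:Z - (j == r)%:Z).
  have := congr1 (fun v : 'rV[int]_n => v 0 r) mE; rewrite !mxE mnm1E eqxx /= => ->.
  by rewrite !(eq_sym r) !natz.
have lj : l = j.
  by have := mlE j; rewrite eqxx (negPf ij); case: eqVneq.
have mi : m = U_(i)%MM.
  apply/mnmP => r; rewrite mnm1E; have := mlE r; rewrite lj addrC subrK.
  by case.
apply: (derivation_below char0 DM).
rewrite -lj DlE mi linearZ /= lin_coef_xbar // eqxx mulr1.
by apply: contraNneq Dl => c0; rewrite DlE c0 scale0r.
Qed.

Lemma below_induces i j : i != j -> below I i j -> exists D : 'End(A),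
  [/\ derivation D,
      induces (homog_derivation (unit_vector i - unit_vector j) (dual_vector k j)) D &
      forall l a, lin_coef l (D a) = (l == i)%:R * lin_coef j a].
Proof.
move=> ij bij; have [D [DE DM Dlin]] := mul_var_deriv var_notin_I bij.
by exists D; split=> // p; rewrite DE homog_derivationE.
Qed.

Lemma below_root i j : i != j -> below I i j ->
  Defs.root I (unit_vector i - unit_vector j).
Proof.
move=> ij bij; have [D [DE DM Dlin]] := mul_var_deriv var_notin_I bij.
split.
  apply/eqP => /matrixP/(_ 0 i); rewrite !mxE !eqxx (negPf ij) /= subr0.
  by move/eqP; rewrite oner_eq0.
exists D; split=> //.
  move=> beta _ [->|[m [c [mE ->]]]]; first by left; rewrite linear0.
  rewrite linearZ /= DE mderivX -scalerAr linearZ /= -mpolyXD.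
  have [mj|mj] := posnP (m j); first by left; rewrite mj scale0r scaler0.
  right; exists (U_(i) + (m - U_(j)))%MM, (c * (m j)%:R); rewrite scalerA; split=> //.
  apply/rowP => l; rewrite -mE !mxE eqxx /= mnmDE mnmBE !mnm1E !(eq_sym l) !natz.
  have [jl|jl] := eqVneq j l; last by rewrite subr0 subn0 addrC PoszD.
  have ml : (0 < m l)%N by rewrite -jl.
  by rewrite PoszD -subzn // addrCA.
apply/eqP => D0; have := Dlin i (xbar I j); rewrite lin_coef_xbar // D0 zero_lfunE linear0 //.
by rewrite !eqxx mulr1 => /eqP; rewrite eq_sym oner_eq0.
Qed.

Lemma diag_block (t : 'rV[k]_n) : block (diag_mx t).
Proof.
by move=> i j; rewrite mxE; case: (eqVneq i j) => [->|]; rewrite ?equivalent_refl ?mulr0n ?eqxx.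
Qed.

Lemma diag_unit (t : 'rV[k]_n) : (forall i, t 0 i != 0) -> diag_mx t \in unitmx.
Proof.
by move=> t0; rewrite unitmxE det_diag unitfE; apply/prodf_neq0 => i _.
Qed.

Lemma linear_subst_diag (t : 'rV[k]_n) i :
  linear_subst I (diag_mx t) (xbar I i) = t 0 i *: xbar I i.
Proof.
rewrite linear_subst_xbar restrict_id; last exact/block_upper/diag_block.
rewrite (bigD1 i) //= mxE eqxx big1 ?addr0 // => l /negPf li.
by rewrite mxE li mulr0n scale0r.
Qed.

Lemma torus_linear_subst g : torus I g <->
  exists2 t : 'rV[k]_n, forall i, t 0 i != 0 & g = linear_subst I (diag_mx t).
Proof.
split=> [[Ag [t t0 gt]]|[t t0 ->]].
  exists (\row_i t i) => [i|]; first by rewrite mxE.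
  have [_ ag] := (AutE g).1 Ag; apply: alg_hom_ext => // [|i]; first exact: alg_hom_linear_subst.
  by rewrite linear_subst_diag mxE.
split; first by apply: linear_subst_Aut; [apply: diag_unit | apply/block_upper/diag_block].
by exists (fun i => t 0 i) => // i; rewrite linear_subst_diag.
Qed.

Lemma torus_levi g : torus I g -> levi g.
Proof.
move=> /torus_linear_subst[t t0 ->]; exists (diag_mx t) => //.
by split; [apply: diag_unit | apply: diag_block].
Qed.

Lemma L1_levi g : L1 I g <-> levi g.
Proof.
split=> [Lg|].
  apply: Lg => [|h [/torus_levi//|[alpha [_ ra rNa [i [j [t [D [ij aE DE hE]]]]]]]]].
    exact: levi_subgroup.
  rewrite aE in ra rNa; have bij := root_below ij ra.
  have bji : below I j i by apply: root_below; [rewrite eq_sym | rewrite -opprB].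
  have [D' [DE' DM' _]] := mul_var_deriv var_notin_I bij.
  have DD' : D = D'.
    by apply: lfun_eq_mon => m; rewrite DE' DE aE homog_derivationE.
  rewrite (is_exp_unique hE (exp_elementary t ij bij _ _)) ?DD' //.
  exists (1%:M + t *: delta_mx i j) => //; split; first exact: elementary_unit.
  by apply: block_elementary; rewrite /equivalent bij.
move=> [B [uB bB] ->] H subH XH.
have [HGL H1 HM HV] := subH.
suff [//] : block B /\ H (linear_subst I B).
apply: (@elimination _ _ equivalent (fun B => block B /\ H (linear_subst I B))) uB bB.
- exact: equivalent_refl.
- exact: equivalent_sym.
- by move=> j i l; apply: equivalent_trans.
- move=> M N [bM HM'] [bN HN]; split; first exact: blockM.
  by rewrite -linear_subst_comp; [apply: HM | apply: block_upper | apply: block_upper].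
- move=> t t0; split; first exact: diag_block.
  by apply: XH; left; apply/torus_linear_subst; exists t.
move=> i j c eij ij; split; first exact: block_elementary.
have /andP[bij bji] := eij; apply: XH; right; exists (unit_vector i - unit_vector j).
have [D [DM DE _]] := below_induces ij bij.
split; last 1 first.
- exists i, j, c, D; split=> //; apply: exp_elementary => // p.
  by rewrite DE homog_derivationE.
- rewrite /Defs.coord_sum; under eq_bigr do rewrite !mxE eqxx /=.
  rewrite sumrB (bigD1 i) //= eqxx big1 => [|l /negPf->//].
  by rewrite (bigD1 j) //= eqxx big1 ?subrr // => l /negPf->.
- exact: below_root.
by rewrite opprB; apply: below_root => //; rewrite eq_sym.
Qed.

End LeviSubgroup.

(** * Standard Levi subgroups *)

Section ClassRepresentatives.

Variables (n : nat) (e : rel 'I_n).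
Hypothesis e_refl : forall i, e i i.
Hypothesis e_sym : forall i j, e i j = e j i.
Hypothesis e_trans : forall j i l, e i j -> e j l -> e i l.

Definition class_repr (i : 'I_n) := odflt i [pick j | e i j].

Lemma class_repr_rel i : e i (class_repr i).
Proof. by rewrite /class_repr; case: pickP. Qed.

Lemma eq_class_repr i j : (class_repr i == class_repr j) = e i j.
Proof.
apply/eqP/idP => [eij|eij].
  apply: e_trans (class_repr_rel i) _; rewrite e_sym eij; exact: class_repr_rel.
have eE : e i =1 e j.
  by move=> l; apply/idP/idP; apply: e_trans; rewrite // e_sym.
rewrite /class_repr (eq_pick eE); case: pickP => // /(_ j).
by rewrite e_refl.
Qed.

(** The classes are laid out as consecutive intervals; s sends an index to its
    position in this layout. *)
Lemma classes_interval : exists (r : nat) (m : 'I_r -> nat) (sum_m : (\sum_j m j)%N = n)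
    (s : 'S_n), (forall j, (0 < m j)%N) /\
  forall i j, (tagnat.sig1 (cast_ord (esym sum_m) (s i)) ==
               tagnat.sig1 (cast_ord (esym sum_m) (s j))) = e i j.
Proof.
pose reps := [set class_repr i | i : 'I_n].
pose cls x := [set i | class_repr i == x].
pose m (j : 'I_#|reps|) := #|cls (enum_val j)|.
have sum_m : (\sum_j m j)%N = n.
  transitivity #|'I_n|; last exact: card_ord.
  rewrite -[RHS]sum1_card (partition_big class_repr (mem reps)) /=; last first.
    by move=> i _; apply: imset_f.
  rewrite (big_enum_val (A := mem reps) (fun x => \sum_(i | class_repr i == x) 1)%N).
  apply: eq_bigr => j _; rewrite sum1_card.
  by apply: eq_card => i; rewrite inE.
exists #|reps|, m, sum_m.
(* f is the inverse of s, up to the identification of the index sets. *)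
pose f (q : 'I_(\sum_j m j)) : 'I_n :=
  enum_val (tagnat.sig2 q : 'I_#|cls (enum_val (tagnat.sig1 q))|).
have fcls q : class_repr (f q) = enum_val (tagnat.sig1 q).
  by have := enum_valP (tagnat.sig2 q : 'I_#|cls (enum_val (tagnat.sig1 q))|); rewrite inE => /eqP.
have f_inj : injective f.
  move=> q q' ff'; have e1 : tagnat.sig1 q = tagnat.sig1 q'.
    by apply: enum_val_inj; rewrite -!fcls ff'.
  have e2 : tagnat.sig2 q = tagnat.sig2 q' :> nat.
    pose x0 := f q; pose c := enum (cls (enum_val (tagnat.sig1 q'))).
    have fE (u : 'I_(\sum_j m j)) : 
        f u = nth x0 (enum (cls (enum_val (tagnat.sig1 u)))) (tagnat.sig2 u).
      exact: enum_val_nth.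
    have bound (u : 'I_(\sum_j m j)) :
        (tagnat.sig2 u < size (enum (cls (enum_val (tagnat.sig1 u)))))%N.
      by rewrite -cardE; apply: (ltn_ord (tagnat.sig2 u)).
    have qc : (tagnat.sig2 q < size c)%N by rewrite /c -e1; apply: bound.
    have qc' : (tagnat.sig2 q' < size c)%N by apply: bound.
    apply/eqP; rewrite -(nth_uniq x0 qc qc' (enum_uniq _)); apply/eqP.
    by rewrite /c -fE -e1 -fE.
  by apply: val_inj; rewrite /= tagnat.rect [RHS]tagnat.rect e2 e1.
have p_inj : injective (fun i => f (cast_ord (esym sum_m) i)).
  by move=> i j /f_inj/cast_ord_inj.
pose p := perm p_inj; exists (p^-1)%g; split=> [j|i j].
  have /imsetP[i _ ji] := enum_valP j.
  by apply/card_gt0P; exists i; rewrite inE ji.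
rewrite -(inj_eq enum_val_inj) -!fcls -eq_class_repr.
have pE l : f (cast_ord (esym sum_m) ((p^-1)%g l)) = l.
  by have := permKV p l; rewrite {1}permE.
by rewrite !pE.
Qed.

End ClassRepresentatives.

Section MatrixEndomorphisms.

Variables (k : fieldType) (n : nat).
Implicit Types (M B : 'M[k]_n) (f g : 'End('cV[k]_n)).

Lemma mx_endE M v : mx_end M v = M *m v.
Proof. by rewrite /mx_end linfunE_linear // => c u w; rewrite linearP. Qed.

Definition end_mx f : 'M[k]_n := \matrix_(i, j) f (delta_mx j 0) i 0.

Lemma mx_endK M : end_mx (mx_end M) = M.
Proof. by apply/matrixP => i j; rewrite mxE mx_endE -colE mxE. Qed.

Lemma end_mxK f : mx_end (end_mx f) = f.
Proof.
apply/lfunP => v; rewrite mx_endE; apply/colP => i; rewrite mxE.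
rewrite [v in RHS]matrix_sum_delta linear_sum summxE; apply: eq_bigr => j _.
by rewrite big_ord1 linearZ !mxE mulrC.
Qed.

Lemma mx_end_comp M B : (mx_end M \o mx_end B)%VF = mx_end (M *m B).
Proof. by apply/lfunP => v; rewrite comp_lfunE !mx_endE mulmxA. Qed.

Lemma mx_end1 : mx_end 1%:M = \1%VF :> 'End('cV[k]_n).
Proof. by apply/lfunP => v; rewrite mx_endE mul1mx id_lfunE. Qed.

Lemma mx_end_inv M : M \in unitmx -> (mx_end M)^-1%VF = mx_end (invmx M).
Proof. by move=> uM; apply: inv_unique; rewrite mx_end_comp mulVmx // mx_end1. Qed.

Lemma GL_mx_end M : GL _ (mx_end M) <-> M \in unitmx.
Proof.
split=> [GM|uM]; last first.
  by apply: (@GL_left_inv _ _ _ (mx_end (invmx M))); rewrite mx_end_comp mulVmx // mx_end1.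
have : M *m end_mx (mx_end M)^-1%VF = 1%:M.
  apply: (can_inj mx_endK); rewrite -mx_end_comp end_mxK.
  by rewrite lker0_compfV // mx_end1.
by case/mulmx1_unit.
Qed.

Lemma end_mx_linear : linear end_mx.
Proof. by move=> c f g; apply/matrixP => i j; rewrite !mxE add_lfunE scale_lfunE !mxE. Qed.

Lemma mx_end_linear : linear (@mx_end k n).
Proof.
move=> c M B; apply/lfunP => v; rewrite add_lfunE scale_lfunE !mx_endE.
by rewrite mulmxDl scalemxAl.
Qed.

Lemma end_mx_comp f g : end_mx (f \o g)%VF = end_mx f *m end_mx g.
Proof. by rewrite -[f in LHS]end_mxK -[g in LHS]end_mxK mx_end_comp mx_endK. Qed.

Definition relation_group (r : rel 'I_n) f :=
  exists2 B, B \in unitmx /\ (forall i j, B i j != 0 -> r i j) & f = mx_end B.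

End MatrixEndomorphisms.

Lemma standard_leviE (k : fieldType) n r (m : 'I_r -> nat) (sum_m : (\sum_j m j)%N = n) f :
  standard_levi k sum_m f <->
  relation_group (fun i j => tagnat.sig1 (cast_ord (esym sum_m) i) ==
                             tagnat.sig1 (cast_ord (esym sum_m) j)) f.
Proof.
case: n / sum_m f => f; split=> [[B uB ->]|[M [uM M0] ->]].
  rewrite castmx_id; exists (\mxdiag_j B j) => //; split.
    have : \mxdiag_j B j *m \mxdiag_j invmx (B j) = 1%:M.
      rewrite {1}/mxdiag mul_mxblock_mxdiag -mxdiagZ; apply/eq_mxblock => i j.
      by case: eqVneq => [<-|]; rewrite ?mul0mx // !conform_mx_id mulmxV.
    by case/mulmx1_unit.
  move=> i j; rewrite !cast_ord_id /mxdiag /mxblock mxE.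
  case: (eqVneq (tagnat.sig1 i) (tagnat.sig1 j)) => // _.
  by rewrite mxE eqxx.
have offdiag (N : 'M[k]_(\sum_j m j)) :
    (forall i j, N i j != 0 -> tagnat.sig1 i == tagnat.sig1 j) ->
    N = \mxdiag_j submxblock N j j.
  move=> N0; rewrite -[LHS]submxblockK; apply/eq_mxblock => i j.
  case: eqVneq => [<-|ij]; first by rewrite conform_mx_id.
  apply/matrixP => a b; rewrite !mxE; apply/eqP; apply: contraNT ij => /N0.
  by rewrite !tagnat.Rank1K.
have {}M0 i j : M i j != 0 -> tagnat.sig1 i == tagnat.sig1 j.
  by move/M0; rewrite !cast_ord_id.
have V0 i j : invmx M i j != 0 -> tagnat.sig1 i == tagnat.sig1 j.
  apply: contraNT => ij; apply/eqP.
  apply: (invmx_stable (V := fun l => tagnat.sig1 l == tagnat.sig1 j)) => //.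
  move=> i' j' /eqP<- nij; apply/eqP; apply: contraNT nij; exact: M0.
exists (fun j => submxblock M j j); last by rewrite castmx_id -offdiag.
move=> j; have := mulmxV uM; rewrite {1}(offdiag M) // {1}(offdiag (invmx M)) //.
rewrite {1}/mxdiag mul_mxblock_mxdiag -mxdiagZ /mxdiag => /eq_mxblockP/(_ j j).
by rewrite eqxx !conform_mx_id => /mulmx1_unit[].
Qed.

Lemma predicate_ext (T : Type) (X Y : T -> Prop) : (forall g, X g <-> Y g) -> X = Y.
Proof.
move=> XY; apply: FunctionalExtensionality.functional_extensionality => g.
exact: PropExtensionality.propositional_extensionality.
Qed.

Lemma conjugateK (k : fieldType) (V : vectType k) (u : 'End(V)) (H : 'End(V) -> Prop) :
  GL V u -> conjugate (u^-1)%VF (conjugate u H) = H.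
Proof.
move=> Gu; apply: predicate_ext => g.
have conjK h : (u^-1 \o (u \o h \o u^-1) \o u)%VF = h.
  by rewrite -!comp_lfunA lker0_compKf // lker0_compVf // comp_lfun1r.
split=> [[_ [h Hh ->] ->]|Hg]; first by rewrite invK_GL // conjK.
by exists (u \o g \o u^-1)%VF; [exists g | rewrite invK_GL // conjK].
Qed.

Section RelationGroup.

Variables (k : fieldType) (n : nat).
Implicit Types (r : rel 'I_n).

Lemma relation_group_perm r r' (s : 'S_n) : (forall i j, r' (s i) (s j) = r i j) ->
  relation_group r = conjugate (mx_end (perm_mx s)) (@relation_group k n r').
Proof.
move=> rr'; apply: predicate_ext => f.
have permE (t : 'S_n) B i j : (perm_mx t *m B *m perm_mx (t^-1)%g) i j = B (t i) (t j) :> k.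
  by rewrite -col_permE -row_permE !mxE.
have unit_perm (t : 'S_n) (B : 'M[k]_n) : B \in unitmx ->
    perm_mx t *m B *m perm_mx (t^-1)%g \in unitmx.
  by move=> uB; rewrite !unitmx_mul !unitmx_perm uB.
have invP : (mx_end (perm_mx s))^-1%VF = mx_end (perm_mx (s^-1)%g) :> 'End('cV[k]_n).
  by apply: inv_unique; rewrite mx_end_comp -perm_mxM mulVg perm_mx1 mx_end1.
split=> [[B [uB rB] ->]|[_ [B [uB rB] ->] ->]]; rewrite ?invP.
  exists (mx_end (perm_mx (s^-1)%g *m B *m perm_mx (s^-1^-1)%g)).
    eexists; last by []; split=> [|i j]; first exact: unit_perm.
    by rewrite permE => /rB; rewrite -rr' !permKV.
  rewrite invP !mx_end_comp; congr (mx_end _); rewrite invgK !mulmxA.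
  rewrite -perm_mxM mulgV perm_mx1 mul1mx.
  by rewrite -mulmxA -perm_mxM mulgV perm_mx1 mulmx1.
rewrite !mx_end_comp; eexists; last by []; split=> [|i j]; first exact: unit_perm.
by rewrite permE => /rB; rewrite rr'.
Qed.

End RelationGroup.

Section LeviMatrices.

Variables (k : fieldType) (n : nat) (I : cofinite_monomial_ideal k n).
Hypothesis char0 : [pchar k] =i pred0.
Hypothesis var_notin_I : forall i : 'I_n, 'X_i \notin (I : {pred {mpoly k[n]}}).
Local Notation A := (quot_alg I).
Local Notation pr := (mod_ideal I).

Lemma algebraic_group_levi : algebraic_group (@levi k n I).
Proof. by split; [apply: levi_subgroup | apply: levi_closed]. Qed.

Lemma algebraic_group_block : algebraic_group (@relation_group k n (equivalent I)).
Proof.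
split; first split.
- by move=> _ [B [uB _] ->]; apply/GL_mx_end.
- exists 1%:M; last by rewrite mx_end1.
  by split; [apply: unitmx1 | apply: block1].
- move=> _ _ [B [uB bB] ->] [B' [uB' bB'] ->]; rewrite mx_end_comp; exists (B *m B') => //.
  by split; [rewrite unitmx_mul uB | apply: blockM].
- move=> _ [B [uB bB] ->]; exists (invmx B); last by rewrite mx_end_inv.
  by rewrite unitmx_inv; split=> //; apply: block_invmx.
pose F (ij : 'I_n * 'I_n) (f : 'End('cV[k]_n)) : k :=
  if equivalent I ij.1 ij.2 then 0 else end_mx f ij.1 ij.2.
apply: closed_ext (_ : zariski_closed (fun f => GL _ f /\ forall ij, F ij f = 0)).
  move=> f; split=> [[Gf Ff]|[B [uB bB] ->]].
    exists (end_mx f); last by rewrite end_mxK.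
    split; first by apply/GL_mx_end; rewrite end_mxK.
    by move=> i j; apply: contraNT => nij; have := Ff (i, j); rewrite /F /= (negPf nij) => ->.
  split; first exact/GL_mx_end.
  move=> [i j]; rewrite /F /= mx_endK; case: ifPn => // nij.
  by apply/eqP; apply: contraNT nij => /bB.
apply: closed_equations => -[i j]; rewrite /F /=.
case: (equivalent I i j); first exact: polynomial_cst.
by apply: polynomial_scalar => c f g; rewrite end_mx_linear !mxE.
Qed.

Lemma levi_block_iso :
  algebraic_iso_by (@levi k n I) (relation_group (equivalent I)) (fun g => mx_end (lin g)).
Proof.
split; [exact: algebraic_group_levi | exact: algebraic_group_block | split |].
- apply/regular_polynomial_map/polynomial_map_linear => c g h.
  by rewrite lin_linear // mx_end_linear.
- by move=> g /levi_lin-/(_ var_notin_I)[ug bg _]; exists (lin g).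
- move=> g h /levi_Aut/AutE[_ ag] _.
  by rewrite lin_comp // mx_end_comp.
exists (fun f => linear_subst I (end_mx f)); split.
- split.
  + apply: regular_polynomial_map.
    apply: (polynomial_map_comp (F := linear_subst I) (F' := @end_mx k n)).
      exact/polynomial_map_linear/end_mx_linear.
    exact: polynomial_linear_subst.
  + by move=> _ [B uB ->]; exists B => //; rewrite mx_endK.
  move=> _ _ [B [uB bB] ->] [B' [uB' bB'] ->].
  by rewrite end_mx_comp !mx_endK linear_subst_comp //; apply: block_upper.
- by move=> g /levi_lin-/(_ var_notin_I)[_ _ gE]; rewrite mx_endK -gE.
move=> _ [B [uB bB] ->]; rewrite mx_endK lin_linear_subst_upper //.
exact: block_upper.
Qed.

Lemma max_ideal_square a : const_coef a = 0 -> (forall i, lin_coef i a = 0) ->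
  a \in (max_ideal I * max_ideal I)%VS.
Proof.
move=> a0 a1; have mX i m : pr 'X_[U_(i) + m] \in max_ideal I.
  rewrite mpolyXD rmorphM; apply: (subvP (sumv_sup i _ (subvv _))) => //.
  by apply: memv_mul; [apply: memv_line | apply: memvf].
rewrite -(mod_ideal_repr a) pr_expand big_seq; apply: memv_suml => m mp; apply: memvZ.
have nz : (repr a)@_m != 0 by rewrite -mcoeff_msupp.
elim/mnm_ind: m {mp} nz => [|m i _]; first by rewrite (a0 : (repr a)@_0%MM = 0) eqxx.
elim/mnm_ind: m => [|m j _].
  by rewrite add0m (a1 i : (repr a)@_U_(i) = 0) eqxx.
rewrite mpolyXD rmorphM => _; apply: memv_mul; first by rewrite addmC; apply: mX.
by rewrite -[U_(i)%MM]addm0; apply: mX.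
Qed.

Lemma cotangent_action_lin (g : 'End(A)) : alg_hom g -> cotangent_action g (mx_end (lin g)).
Proof.
move=> ag v; set w := \sum_i v i 0 *: xbar I i.
have w0 (v' : 'cV[k]_n) : const_coef (\sum_i v' i 0 *: xbar I i) = 0.
  by rewrite linear_sum big1 // => i _; rewrite linearZ /= const_coef_xbar mulr0.
have w1 l (v' : 'cV[k]_n) : lin_coef l (\sum_i v' i 0 *: xbar I i) = v' l 0.
  rewrite linear_sum (bigD1 l) //= linearZ /= lin_coef_xbar // eqxx mulr1 big1 ?addr0 // => i il.
  by rewrite linearZ /= lin_coef_xbar // eq_sym (negPf il) mulr0.
apply: max_ideal_square => [|l].
  by rewrite linearB /= const_coef_alg_hom // !w0 subrr.
rewrite linearB /= lin_coef_alg_hom // w1 mx_endE mxE; apply/eqP; rewrite subr_eq0; apply/eqP.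
by apply: eq_bigr => j _; rewrite w1.
Qed.

End LeviMatrices.

(** * Conjugating a semisimple element into the Levi subgroup *)

Section Separation.

Variables (k : fieldType) (n : nat) (I : cofinite_monomial_ideal k n).
Local Notation strict := (strict I).
Implicit Types (M X Y : 'M[k]_n).

Definition depth (j : 'I_n) := #|[pred l | below I l j]|.

Lemma depth_strict i j : strictly_below I i j -> (depth i < depth j)%N.
Proof.
move=> /andP[ij ji]; apply/proper_card/properP; split.
  by apply/subsetP => l li; apply: below_trans li ij.
by exists j; rewrite inE ?below_refl.
Qed.

Lemma strict_unit Y : strict Y -> 1%:M + Y \in unitmx.
Proof.
move=> sY; rewrite -row_free_unit; apply: inj_row_free => v vY.
suff v0 d j : (depth j < d)%N -> v 0 j = 0.
  by apply/rowP => j; rewrite mxE; apply: v0 (ltnSn (depth j)).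
elim: d j => // d IHd j jd; have /rowP/(_ j) := vY.
rewrite mulmxDr mulmx1 !mxE big1 ?addr0 // => l _.
have [->|/sY/depth_strict lj] := eqVneq (Y l j) 0; first by rewrite mulr0.
by rewrite IHd ?mul0r // (leq_trans lj).
Qed.

(** The equation (1 + Y) (t + X) = t (1 + Y) expresses the column j of Y in
    terms of the columns l strictly below j, whence iterating its right hand
    side from 0 reaches a solution. *)
Lemma strict_conjugation (c : 'rV[k]_n) X : strict X ->
    (forall i j, c 0 i = c 0 j -> equivalent I i j) ->
  exists2 Y, strict Y & (1%:M + Y) *m (diag_mx c + X) = diag_mx c *m (1%:M + Y).
Proof.
move=> sX c_inj.
pose F Y : 'M[k]_n := \matrix_(i, j)
  if strictly_below I i j then (X i j + (Y *m X) i j) / (c 0 i - c 0 j) else 0.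
have sF Y : strict (F Y) by move=> i j; rewrite mxE; case: ifP => // _ /eqP.
have stable d i j : (depth j <= d)%N -> iter d F 0 i j = iter d.+1 F 0 i j.
  elim: d i j => [|d IHd] i j jd.
    by move: jd; rewrite leqNgt; case/negP; apply/card_gt0P; exists j; apply: below_refl.
  rewrite -[LHS]/(F (iter d F 0) i j) -[RHS]/(F (iter d.+1 F 0) i j) [LHS]mxE [RHS]mxE.
  case: ifP => // _; congr (_ / _); congr (_ + _).
  rewrite !mxE; apply: eq_bigr => l _.
  have [->|/sX/depth_strict lj] := eqVneq (X l j) 0; first by rewrite !mulr0.
  by congr (_ * _); apply: IHd; rewrite -ltnS (leq_trans lj).
pose Y := iter n F 0; have YF : F Y = Y.
  apply/matrixP => i j; rewrite -[F Y]/(iter n.+1 F 0) -stable //.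
  by rewrite -[X in (_ <= X)%N]card_ord max_card.
have sY : strict Y by rewrite -YF.
exists Y => //; rewrite !(mulmxDr, mulmxDl) mulmx1 !mul1mx -addrA; congr (_ + _).
have YE i j : strictly_below I i j -> Y i j = (X i j + (Y *m X) i j) / (c 0 i - c 0 j).
  by move=> ij; rewrite -[in LHS]YF mxE ij.
have : strict (Y *m X) by apply: upper_strictM => //; apply: strict_upper.
move: (Y *m X) YE => Z YE sZ; apply/matrixP => i j; rewrite mul_mx_diag mul_diag_mx !mxE.
case: (boolP (strictly_below I i j)) => [ij|nij]; last first.
  have z M : strict M -> M i j = 0 by move=> sM; apply/eqP; apply: contraNT nij; apply: sM.
  by rewrite !z // mul0r mulr0 !addr0.
have cij : c 0 i - c 0 j != 0.
  rewrite subr_eq0; apply: contraTneq ij => /c_inj e.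
  by apply/negP => /strictly_below_not_equivalent; rewrite e.
have /(canLR (divfK cij)) e := YE i j ij.
by rewrite addrCA -e mulrBr addrC subrK mulrC.
Qed.

End Separation.

Section LeviComplement.

Variables (k : closedFieldType) (n : nat) (I : cofinite_monomial_ideal k n).
Hypothesis char0 : [pchar k] =i pred0.
Hypothesis var_notin_I : forall i : 'I_n, 'X_i \notin (I : {pred {mpoly k[n]}}).
Local Notation A := (quot_alg I).
Local Notation G0 := (neutral_component (Aut I)).
Implicit Types (g h : 'End(A)).
Variables R L : 'End(A) -> Prop.
Hypothesis radR : is_unipotent_radical (Aut I) R.
Hypothesis G0_RL : semidirect_product G0 R L.

Lemma levi_neutral g : levi g -> G0 g.
Proof.
by move=> [B [uB bB] ->]; apply: linear_subst_neutral => //; apply: block_upper.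
Qed.

Definition upper_Aut g := Aut I g /\ upper I (lin g).

Lemma upper_Aut_comp g h : upper_Aut g -> upper_Aut h -> upper_Aut (g \o h)%VF.
Proof.
move=> [Ag ug] [Ah uh]; have [_ _ AM _] := Aut_subgroup I; split; first exact: AM.
by have [_ ag] := (AutE g).1 Ag; rewrite lin_comp //; apply: upperM.
Qed.

Lemma levi_part_comp g h : upper_Aut g -> upper_Aut h ->
  levi_part (g \o h)%VF = (levi_part g \o levi_part h)%VF.
Proof.
move=> [/AutE[_ ag] ug] [_ uh].
rewrite /levi_part lin_comp // block_partM // linear_subst_comp //;
by apply: block_upper; apply: block_part_block.
Qed.

Lemma levi_part_radical g : radical g -> levi_part g = \1%VF.
Proof. by move=> rg; rewrite /levi_part block_part_radical // linear_subst1. Qed.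

Lemma upper_strict M : upper I M -> block_part I M = 0 -> strict I M.
Proof.
move=> uM M0 i j nz; have := uM i j nz; rewrite below_split => /orP[eij|//].
have := congr1 (fun N : 'M[k]_n => N i j) M0; rewrite !mxE eij => Mij.
by rewrite Mij eqxx in nz.
Qed.

Lemma radical_block_part g : upper_Aut g -> block_part I (lin g) = 1%:M -> radical g.
Proof.
move=> [Ag ug] bg; split=> //; apply: upper_strict.
  by apply: upperD ug _; rewrite -scaleN1r; apply: upperZ; apply: upper1.
have := block_partD I (lin g - 1%:M) 1%:M.
rewrite subrK bg (block_part_id (@block1 _ _ I)) => e.
by apply: (addIr 1%:M); rewrite add0r -e.
Qed.

(** The projection of the neutral component onto L along R is an isomorphism
    from any other complement, here the group of block matrices, whose own
    projection is the inverse. *)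
Lemma L_levi_iso : algebraic_iso_by L (@levi k n I) (@levi_part k n I).
Proof.
have RE := unipotent_radicalE char0 var_notin_I radR.
case: G0_RL => aR aL [RG0 RN] LG0 [rho [lambda [_ reg_lambda decomp uniq]]].
have [[LGL L1 LM LV] _] := aL; have [[_ _ RM RV] _] := aR.
have [[VGL V1 VM VV] _] := algebraic_group_levi var_notin_I.
have G0E g (G0g : G0 g) : upper_Aut g := neutral_upper char0 var_notin_I G0g.
have lambdaM g h : G0 g -> G0 h ->
    lambda (g \o h)%VF = (lambda g \o lambda h)%VF.
  move=> Gg Gh; have [Rr Ll {1}->] := decomp g Gg; have [Rr' Ll' {1}->] := decomp h Gh.
  have -> : (rho g \o lambda g \o (rho h \o lambda h) =
     (rho g \o (lambda g \o rho h \o (lambda g)^-1)) \o (lambda g \o lambda h))%VF.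
    by rewrite !comp_lfunA lker0_compfVK //; apply: LGL.
  have [//|//|_ ->//] := uniq
    (rho g \o (lambda g \o rho h \o (lambda g)^-1))%VF (lambda g \o lambda h)%VF.
    by apply: RM => //; apply: RN => //; apply: LG0.
  exact: LM.
split=> //; first exact: algebraic_group_levi.
  split=> [|g /LG0/G0E[]|g h /LG0/G0E Gg /LG0/G0E Gh]; last exact: levi_part_comp.
    exact/regular_polynomial_map/polynomial_levi_part.
  exact: levi_part_levi.
exists lambda; split.
- split=> [|g /levi_neutral/decomp[] //|g h /levi_neutral Gg /levi_neutral Gh].
    exact: regular_on_sub levi_neutral reg_lambda.
  exact: lambdaM.
- move=> g Lg; have [Ag ug] := G0E g (LG0 g Lg).
  have lg := levi_part_levi var_notin_I Ag ug.
  have lE : lin (levi_part g) = block_part I (lin g).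
    by apply: lin_linear_subst_upper => //; apply/block_upper/block_part_block.
  move: (levi_part g) lg lE => l lg lE; have Gl : GL A l by apply: VGL.
  have [_ ag] := (AutE g).1 Ag.
  have [Al ul] : upper_Aut (l^-1)%VF := G0E _ (levi_neutral (VV _ lg)).
  have Rr : R (g \o l^-1)%VF.
    apply/RE/radical_block_part; first by apply: upper_Aut_comp => //; apply: G0E (LG0 g Lg).
    rewrite lin_comp // (block_partM ug ul) (lin_inv var_notin_I (levi_Aut lg)).
    have [ul' bl _] := levi_lin var_notin_I lg.
    by rewrite (block_part_id (block_invmx ul' bl)) lE mulmxV // -lE.
  have [_] := uniq _ _ (RV _ Rr) Lg.
  by rewrite (inv_comp (LGL _ Lg) (GL_inv Gl)) invK_GL // lker0_compfVK //; apply: LGL.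
move=> g lg; have Gg := levi_neutral lg; have [Rr Ll gE] := decomp g Gg.
rewrite -[RHS](levi_part_id var_notin_I lg) {2}gE levi_part_comp;
  [|exact/G0E/RG0|exact/G0E/LG0].
by rewrite (levi_part_radical (proj1 (RE _) Rr)) comp_lfun1l.
Qed.

End LeviComplement.

Section Conjugation.

Variables (k : closedFieldType) (n : nat) (I : cofinite_monomial_ideal k n).
Hypothesis char0 : [pchar k] =i pred0.
Hypothesis var_notin_I : forall i : 'I_n, 'X_i \notin (I : {pred {mpoly k[n]}}).
Local Notation A := (quot_alg I).
Local Notation G0 := (neutral_component (Aut I)).
Implicit Types (g h l : 'End(A)).
Variables R L : 'End(A) -> Prop.
Hypothesis radR : is_unipotent_radical (Aut I) R.
Hypothesis G0_RL : semidirect_product G0 R L.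

(** A scalar matrix on each class, with different scalars: its centralizer
    consists of block matrices. *)
Definition class_scalars : 'rV[k]_n := \row_i (class_repr (equivalent I) i).+1%:R.

Lemma class_scalars_eq i j : (class_scalars 0 i == class_scalars 0 j) = equivalent I i j.
Proof.
rewrite !mxE (inj_eq (natr_inj char0)) eqSS val_eqE eq_class_repr //.
- exact: equivalent_refl.
- exact: equivalent_sym.
by move=> j' i' l; apply: equivalent_trans.
Qed.

Lemma levi_class_scalars : levi (linear_subst I (diag_mx class_scalars)).
Proof.
exists (diag_mx class_scalars) => //; split; last exact: diag_block.
by apply: diag_unit => i; rewrite mxE natr_neq0.
Qed.

Lemma lin_class_scalars :
  lin (linear_subst I (diag_mx class_scalars)) = diag_mx class_scalars.
Proof. by apply: lin_linear_subst_upper => //; apply/block_upper/diag_block. Qed.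

Lemma class_scalars_central B : block I B ->
  diag_mx class_scalars *m B = B *m diag_mx class_scalars.
Proof.
move=> bB; apply/matrixP => i j; rewrite mul_diag_mx mul_mx_diag !mxE mulrC.
have [->|/bB] := eqVneq (B i j) 0; first by rewrite !mul0r.
by rewrite -class_scalars_eq !mxE => /eqP->.
Qed.

Lemma class_scalars_centralizer M :
  diag_mx class_scalars *m M = M *m diag_mx class_scalars -> block I M.
Proof.
move=> e i j nz; have /matrixP/(_ i j) := e.
rewrite mul_diag_mx mul_mx_diag mxE [RHS]mxE mulrC => /(mulfI nz)/eqP.
by rewrite class_scalars_eq.
Qed.

Lemma radical_neutral u : R u -> G0 u.
Proof. by case: G0_RL => _ _ [RG0 _] _ _; apply: RG0. Qed.

Lemma neutral_upper_Aut g : G0 g -> upper_Aut g.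
Proof. exact: neutral_upper. Qed.

Lemma levi_part_conjugate u g : R u -> upper_Aut g ->
  levi_part (u \o g \o u^-1)%VF = levi_part g.
Proof.
move=> Ru ug; have RE := unipotent_radicalE char0 var_notin_I radR.
have [[_ _ _ RV] _] : algebraic_group R by case: G0_RL.
have uu v : R v -> upper_Aut v by move/radical_neutral/neutral_upper_Aut.
have p1 v : R v -> levi_part v = \1%VF by move/RE/levi_part_radical.
have uug := upper_Aut_comp var_notin_I (uu _ Ru) ug.
rewrite (levi_part_comp var_notin_I uug (uu _ (RV _ Ru))).
rewrite (levi_part_comp var_notin_I (uu _ Ru) ug).
by rewrite (p1 _ Ru) (p1 _ (RV _ Ru)) comp_lfun1l comp_lfun1r.
Qed.

Lemma L_upper l : L l -> upper_Aut l.
Proof. by case: G0_RL => _ _ _ LG0 _ /LG0/neutral_upper_Aut. Qed.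

Lemma L_subgroup : subgroup L.
Proof. by case: G0_RL => _ []. Qed.

(** An element of L over the class scalars is central in L, since L embeds into
    the block matrices; once its linear part is the scalars themselves, the
    whole of L is in their centralizer. *)
Lemma conjugate_block u l0 : R u -> L l0 ->
    lin (u \o l0 \o u^-1)%VF = diag_mx class_scalars ->
  forall l, L l -> block I (lin (u \o l \o u^-1)%VF).
Proof.
move=> Ru Ll0 linl0 l Ll; have [LGL _ LM _] := L_subgroup.
have [_ _ [_ Lp _] [E [_ pK _]]] := L_levi_iso char0 var_notin_I radR G0_RL.
have pl0 : levi_part l0 = linear_subst I (diag_mx class_scalars).
  rewrite -(levi_part_conjugate Ru (L_upper Ll0)) /levi_part linl0 block_part_id //.
  exact: diag_block.
have ll0 : (l0 \o l = l \o l0)%VF.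
  rewrite -(pK _ (LM _ _ Ll0 Ll)) -(pK _ (LM _ _ Ll Ll0)); congr (E _).
  rewrite (levi_part_comp var_notin_I (L_upper Ll0) (L_upper Ll)).
  rewrite (levi_part_comp var_notin_I (L_upper Ll) (L_upper Ll0)) pl0.
  have [_ bl ->] := levi_lin var_notin_I (Lp l Ll).
  move: (lin (levi_part l)) bl => B /[dup] bB /block_upper uB.
  have uD : upper I (diag_mx class_scalars) by apply/block_upper/diag_block.
  by rewrite (linear_subst_comp uD uB) (linear_subst_comp uB uD) class_scalars_central.
have Au : Aut I u by have [] := neutral_upper_Aut (radical_neutral Ru).
have [Gu _] := (AutE u).1 Au; have [_ _ AM AV] := Aut_subgroup I.
have alg_conj g : L g -> alg_hom (u \o g \o u^-1)%VF.
  move=> /L_upper[Ag _].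
  by have /AutE[] := AM _ _ (AM _ _ Au Ag) (AV _ Au).
apply: class_scalars_centralizer.
rewrite -linl0 -(lin_comp var_notin_I _ (alg_conj _ Ll0)) -(lin_comp var_notin_I _ (alg_conj _ Ll)).
have conjM g h : (u \o g \o u^-1 \o (u \o h \o u^-1) = u \o (g \o h) \o u^-1)%VF.
  by rewrite !comp_lfunA lker0_compfVK.
by rewrite !conjM ll0.
Qed.

Lemma block_conjugator : exists u,
  [/\ R u, included (torus I) L -> u = \1%VF &
      forall l, L l -> block I (lin (u \o l \o u^-1)%VF)].
Proof.
have RE := unipotent_radicalE char0 var_notin_I radR.
have [[_ R1 _ _] _] : algebraic_group R by case: G0_RL.
have [TL|nTL] := classic (included (torus I) L).
  exists \1%VF; split=> //; apply: (conjugate_block R1 (TL _ _)).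
    by apply/torus_linear_subst => //; exists class_scalars => // i; rewrite mxE natr_neq0.
  by rewrite inv_lfun1 comp_lfun1l comp_lfun1r lin_class_scalars.
have [_ _ _ [E [[_ EL _] _ EK]]] := L_levi_iso char0 var_notin_I radR G0_RL.
pose t := linear_subst I (diag_mx class_scalars); pose l0 := E t.
have Ll0 : L l0 by apply/EL/levi_class_scalars.
have [Al0 ul0] := L_upper Ll0; have [_ al0] := (AutE l0).1 Al0.
have pl0 : block_part I (lin l0) = diag_mx class_scalars.
  have := congr1 (@lin k n I) (EK t levi_class_scalars).
  rewrite lin_class_scalars lin_linear_subst_upper //.
  exact/block_upper/block_part_block.
pose X := lin l0 - diag_mx class_scalars.
have ut : upper I (diag_mx class_scalars) by apply/block_upper/diag_block.
have sX : strict I X.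
  apply: upper_strict.
    by apply: upperD ul0 _; rewrite -scaleN1r; apply: upperZ.
  have := block_partD I X (diag_mx class_scalars).
  rewrite subrK pl0 (block_part_id (@diag_block _ _ I class_scalars)).
  by move=> e; apply: (addIr (diag_mx class_scalars)); rewrite add0r -e.
have [i j /eqP|Y sY YE] := @strict_conjugation _ _ I class_scalars X sX.
  by rewrite class_scalars_eq.
have uY := strict_unit sY; have upY : upper I (1%:M + Y).
  by apply: upperD; [apply: upper1 | apply: strict_upper].
pose u := linear_subst I (1%:M + Y).
have Ru : R u.
  apply/RE; split; first exact: linear_subst_Aut.
  by rewrite lin_linear_subst_upper // addrC addKr.
exists u; split=> //; apply: (conjugate_block Ru Ll0).
have [_ au] := (AutE u).1 (linear_subst_Aut uY upY).
rewrite !lin_comp //; last exact: alg_hom_comp.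
rewrite lin_inv; [|exact: var_notin_I|exact: linear_subst_Aut].
have -> : lin l0 = diag_mx class_scalars + X by rewrite addrC subrK.
by rewrite lin_linear_subst_upper // YE mulmxK.
Qed.

End Conjugation.

Theorem proposition2p7 (k : closedFieldType) (char0 : [pchar k] =i pred0)
    (n : nat) (n_gt0 : (0 < n)%N) (I : cofinite_monomial_ideal k n)
    (var_notin_I : forall i : 'I_n, 'X_i \notin (I : {pred {mpoly k[n]}}))
    (R L : 'End(quot_alg I) -> Prop)
    (radR : is_unipotent_radical (Aut I) R)
    (redL : reductive L)
    (G0_RL : semidirect_product (neutral_component (Aut I)) R L) :
  algebraic_isomorphic L (L1 I) /\
  exists (r : nat) (m : 'I_r -> nat) (sum_m : (\sum_j m j)%N = n)
         (s : 'S_n) (u : 'End(quot_alg I)),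
    [/\ forall j, (0 < m j)%N,
        R u /\ (included (torus I) L -> u = \1%VF),
        exists2 a : 'End(quot_alg I) -> 'End('cV[k]_n),
          algebraic_iso_by (conjugate u L)
            (conjugate (mx_end (perm_mx s)) (standard_levi k sum_m)) a &
          forall g, conjugate u L g -> cotangent_action g (a g) &
        algebraic_isomorphic L (standard_levi k sum_m)].
Proof.
have Llevi := L_levi_iso char0 var_notin_I radR G0_RL.
have L1E : L1 I = @levi k n I by apply: predicate_ext => g; apply: L1_levi.
split; first by exists (@levi_part k n I); rewrite L1E.
have Lblock := algebraic_iso_trans Llevi (levi_block_iso var_notin_I).
have [r [m [sum_m [s [m_gt0 sE]]]]] := classes_interval (@equivalent_refl k n I)
  (@equivalent_sym k n I) (@equivalent_trans k n I).
have [u [Ru uT ublock]] := block_conjugator char0 var_notin_I radR G0_RL.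
have blockE : relation_group (equivalent I) =
    conjugate (mx_end (perm_mx s)) (standard_levi k sum_m).
  rewrite (predicate_ext (standard_leviE sum_m)); exact: relation_group_perm.
exists r, m, sum_m, s, u; split=> //.
  have [aL _ _ _] := Llevi.
  have uG := neutral_upper_Aut char0 var_notin_I (radical_neutral G0_RL Ru).
  have [Gu au] := (AutE u).1 uG.1.
  exists (fun g => mx_end (lin g)); last first.
    move=> _ [l Ll ->]; apply: cotangent_action_lin => //.
    have [Al _] := L_upper char0 var_notin_I G0_RL Ll.
    apply: alg_hom_comp; last exact: alg_hom_inv.
    by apply: alg_hom_comp => //; case/AutE: Al.
  rewrite -blockE; apply: algebraic_iso_ext (algebraic_iso_trans (conjugate_iso Gu aL) Lblock).
  move=> _ [l Ll ->] /=; congr (mx_end _).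
  rewrite -!comp_lfunA lker0_compKf // lker0_compVf // comp_lfun1r.
  have ul := L_upper char0 var_notin_I G0_RL Ll.
  rewrite -(levi_part_conjugate char0 var_notin_I radR G0_RL Ru ul).
  have bl := ublock l Ll; rewrite /levi_part block_part_id // comp_lfunA.
  by rewrite lin_linear_subst_upper //; apply: block_upper.
have [_ aB _ _] := Lblock.
have GP : GL _ (mx_end (perm_mx s) : 'End('cV[k]_n)) by apply/GL_mx_end; rewrite unitmx_perm.
have [astd _ _ _] := conjugate_iso (GL_inv GP) aB.
rewrite blockE conjugateK // in astd Lblock.
eexists; exact: algebraic_iso_trans Lblock (conjugate_iso GP astd).
Qed.
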